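(* Let $G$ be a locally compact group and let $A$ be a closed unital translation-invariant subalgebra of $B(G)$. Then the spectrum $\Delta(A)$ of $A$ is a compact semitopological $*$-semigroup.
   Context: $B(G)$ is the Fourier–Stieltjes algebra of $G$. For a continuous unitary representation $\{\pi,\mathcal H_\pi\}$ of $G$, $A_\pi$ is the closed linear span in $B(G)$ of the functions $\xi*_\pi\eta(s)=\langle\pi(s)\xi|\eta\rangle$ ($\xi,\eta\in\mathcal H_\pi$), and $VN_\pi$ is the von Neumann algebra generated by $\pi(G)$, identified with $A_\pi^*$ via $\langle T,\xi*_\pi\eta\rangle=\langle T\xi|\eta\rangle$. Every closed translation-invariant subspace of $B(G)$ is of the form $A_\pi$; write $A=A_\pi$. $\Delta(A)\subseteq A^*=VN_\pi$ is the Gelfand spectrum (nonzero multiplicative linear functionals on $A$) with the weak$^*$-topology. The product and involution on $\Delta(A)$ are those of the von Neumann algebra $VN_\pi$; the assertion includes that $\Delta(A)$ is closed under them. ''Semitopological'' means that multiplication is separately continuous. *)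

(* Defs.v *)
From HB Require Import structures.
From mathcomp Require Import all_boot all_order all_algebra.
From mathcomp Require Import all_classical all_reals all_analysis.
From mathcomp Require Import complex.
Set Implicit Arguments.
Unset Strict Implicit.
Unset Printing Implicit Defensive.
Import Order.TTheory GRing.Theory Num.Theory.
Import numFieldNormedType.Exports.
Local Open Scope classical_set_scope.
Local Open Scope ring_scope.

(* The norm and topology instances are declared on numClosedFieldType, not on R[i] itself. *)
Definition Cplx (R : realType) : numClosedFieldType := R[i]%C.

HB.mixin Record isTopologicalGroup G of Group G & Topological G := {
  mulg_continuous : continuous (fun p : G * G => (p.1 * p.2)%g);
  invg_continuous : continuous (fun s : G => (s^-1)%g)
}.

#[short(type="topGroupType")]
HB.structure Definition TopGroup :=
  {G of Group G & Topological G & isTopologicalGroup G}.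

(* {dot H for Num.conj} is linear in its first argument and conjugate-linear in its
   second one. *)
HB.mixin Record hasInnerProduct (R : realType) H
    of CompleteNormedModule (Cplx R) H := {
  ip : {dot H for (@Num.conj (Cplx R))};
  ip_norm : forall x : H, ip x x = `|x| ^+ 2
}.

#[short(type="hilbertType")]
HB.structure Definition Hilbert (R : realType) :=
  {H of hasInnerProduct R H & CompleteNormedModule (Cplx R) H}.

(* The operators are invertible by rep1 and repM, so that preserving the inner product
   makes them unitary. *)
Record unirep (R : realType) (G : topGroupType) := UniRep {
  rep_space : hilbertType R;
  rep_act :> G -> {linear rep_space -> rep_space};
  rep_isometry : forall s x y, ip (rep_act s x) (rep_act s y) = ip x y;
  rep1 : forall x, rep_act 1%g x = x;
  repM : forall s t x, rep_act (s * t)%g x = rep_act s (rep_act t x);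
  rep_continuous : forall x, continuous (fun s => rep_act s x)
}.

Section FourierStieltjes.
Variables (R : realType) (G : topGroupType).
Implicit Types (pi : unirep R G) (u v : G -> Cplx R) (A : set (G -> Cplx R)).

Definition coef pi (x y : rep_space pi) : G -> Cplx R := fun s => ip (pi s x) y.

Definition FS : set (G -> Cplx R) :=
  [set u | exists pi (x y : rep_space pi), u = coef x y].

(* Meaningful on FS only: the infimum of the empty set is 0. *)
Definition FSnorm u : R :=
  inf [set r | exists pi (x y : rep_space pi),
    u = coef x y /\ r = complex.Re (`|x| * `|y|)].

Definition FSclosure A : set (G -> Cplx R) :=
  [set u | FS u /\ forall e : R, 0 < e -> exists2 v, A v & FSnorm (u - v) < e].

Definition FSclosed A := FSclosure A `<=` A.

Definition coef_span pi : set (G -> Cplx R) :=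
  [set u | exists (n : nat) (c : 'I_n -> Cplx R) (x y : 'I_n -> rep_space pi),
    u = \sum_(i < n) c i *: coef (x i) (y i)].

Definition coef_space pi : set (G -> Cplx R) := FSclosure (coef_span pi).

Definition unital_subalgebra A :=
  [/\ A `<=` FS, A 1,
      forall u v, A u -> A v -> A (u + v),
      forall (c : Cplx R) u, A u -> A (c *: u)
    & forall u v, A u -> A v -> A (u * v)].

Definition translation_invariant A :=
  forall (s : G) u, A u ->
    A (fun t => u (s * t)%g) /\ A (fun t => u (t * s)%g).

(* As A is only a subset of G -> C, the sum and product of two elements u and v of A are
   represented by any w : A with the corresponding underlying function. *)
Definition spectrum A : set {ptws A -> Cplx R} :=
  [set chi |
    [/\ forall (c : Cplx R) (u v w : A),
          \val w = c *: \val u + \val v -> chi w = c * chi u + chi v,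
        forall u v w : A, \val w = \val u * \val v -> chi w = chi u * chi v
      & exists u : A, chi u != 0]].

End FourierStieltjes.

Arguments spectrum {R G} A.

Section VonNeumann.
Variables (R : realType) (H : hilbertType R).
Implicit Types (T S : H -> H) (M : set (H -> H)).

Definition bounded_ops : set (H -> H) := [set T | linear T /\ continuous T].

Definition adjoint T S := forall x y : H, ip (T x) y = ip x (S y).

Definition commutant M : set (H -> H) :=
  [set T | bounded_ops T /\ forall S, M S -> T \o S = S \o T].

Definition von_neumann_algebra M :=
  [/\ M `<=` bounded_ops,
      forall T S, M T -> bounded_ops S -> adjoint T S -> M S
    & commutant (commutant M) = M].

End VonNeumann.

Definition VN (R : realType) (G : topGroupType) (pi : unirep R G) :
    set (rep_space pi -> rep_space pi) :=
  smallest (@von_neumann_algebra R (rep_space pi))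
    [set T : rep_space pi -> rep_space pi | exists s : G, T = pi s].

Arguments VN {R G} pi.

Definition semitopological_star_semigroup (S : topologicalType)
    (mul : S -> S -> S) (star : S -> S) :=
  [/\ associative mul,
      forall a, continuous (mul a) /\ continuous (mul ^~ a),
      involutive star,
      forall a b, star (mul a b) = mul (star b) (star a)
    & continuous star].

(* Main.v *)
Require Import Defs.
From HB Require Import structures.
From mathcomp Require Import all_boot all_order all_algebra.
From mathcomp Require Import all_classical all_reals all_analysis.
From mathcomp Require Import complex ring.
Import Order.TTheory GRing.Theory Num.Theory.
Import numFieldNormedType.Exports.
Local Open Scope classical_set_scope.
Local Open Scope ring_scope.
Set Implicit Arguments.
Unset Strict Implicit.
Unset Printing Implicit Defensive.

(** The spectrum acts on the Hilbert space of any representation [pi] with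
    [A = coef_space pi]: the form [chi (coef x y)] is sesquilinear, so a bounded [chi]
    is represented by an operator [T] with [chi (coef x y) = ip (T x) y]. Products and
    adjoints of such operators have to be recognized as members of the spectrum again.

    Two things about representations are needed: to build enough of them, and to know
    that elements of the spectrum are bounded. Both rest on one construction, [GNS]. A
    positive kernel defines a Hilbert space of functions; if the kernel is invariant
    under translation, then translations act on that space as a unitary
    representation whose coefficients are given by the kernel. Operations on
    representations thus become operations on kernels: entrywise products of kernels
    replace tensor products ([psd_mul], Schur's theorem), block diagonal kernels
    replace direct sums ([psd_block]), and a limit of kernels replaces the infinite
    sum of the tensor powers ([psd_geometric]).

    A multiplicative functional [f] satisfies [`|f (coef x y)| <= `|x| * `|y|]
    ([functional_le]). Otherwise scaling gives a coefficient [w = coef x y] in [A]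
    with [f w = 1] and [`|x| = `|y| < 1]. The geometric series [v = w + w^2 + ...]
    converges in [A], because its tails are coefficients of vectors whose norms tend
    to zero, and [v = w + w * v] gives the absurd [f v = 1 + f v].

    A closed translation-invariant linear space contains, with a coefficient
    [coef x y], all coefficients of the vectors of the invariant subspaces generated
    by [x] and by [y], once these two subspaces agree; and projecting [x] and [y]
    makes them agree ([coef_cocyclic]). So [A] is the set of all coefficients of a
    single representation ([universal_representation]), each element being one
    coefficient rather than a limit of sums.

    The product has an intrinsic description, with no representation chosen:
    [chi psi (u) = chi (s |-> psi (t |-> u (s t)))], and the star of [chi] sends [u]
    to the conjugate of [chi (s |-> conj (u (s^-1)))]. The inner functions belong to
    [A] because for [u = coef x y] they are [coef (T x) y], where [T] is the operator
    of [psi], and [coef y x]. Multiplicativity and associativity are then pointwise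
    computations. Evaluating the two variables in the other order gives the same
    value, namely the coefficient at [(x, y)] of the product of the operators
    ([introvert_exchange]). This exchange makes the product continuous in each
    variable, since [chi psi (u)] is the value of either factor at an element of [A]
    which depends only on [u] and the other factor; and it makes the star reverse
    products.

    Compactness is the argument of Banach and Alaoglu. By the bound, the spectrum lies
    in a product of compact squares of complex numbers; it is closed there, the
    condition of being nonzero surviving in the limit because it amounts to taking the
    value 1 at the constant 1. Finally, the operators lie in [VN pi] because they
    commute with every bounded operator that commutes with the representation
    ([functional_operator_VN]), and they determine the functionals because sums of
    coefficients are dense ([spectrum_eq_coef]). *)

(** * Limits and complex numbers *)

Section Limits.
Variable K : numClosedFieldType.

Lemma norm_small_eq0 (z : K) : (forall e : K, 0 < e -> `|z| <= e) -> z = 0.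
Proof.
move=> h; apply/eqP; rewrite -normr_eq0 -[_ == _]negbK; apply/negP => z0.
have zp : 0 < `|z| by rewrite lt_def z0/=.
have := h (`|z| / 2) (divr_gt0 zp (ltr0Sn _ _)).
by rewrite ler_pdivlMr// mulr_natr mulr2n gerDl (lt_geF zp).
Qed.

Section FilterLimits.
Variables (T : Type) (F : set_system T) (FF : ProperFilter F).
Implicit Types (c d : T -> K) (l m : K).

Lemma lim_unique c l m : c @ F --> l -> c @ F --> m -> l = m.
Proof.
move=> /cvgrPdist_lt cl /cvgrPdist_lt cm.
apply/eqP; rewrite -subr_eq0; apply/eqP; apply: norm_small_eq0 => e e0.
have e20 : 0 < e / 2 by rewrite divr_gt0.
have [t [h1 h2]] := filter_ex (@filterI _ F _ _ _ (cl _ e20) (cm _ e20)).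
apply: ltW; rewrite -(subrKA (c t)) (splitr e).
by apply: le_lt_trans (ler_normD _ _) _; rewrite ltrD// distrC.
Qed.

Lemma lim_ext c d l : c =1 d -> c @ F --> l -> d @ F --> l.
Proof. by move=> /funext ->. Qed.

Lemma lim_cst (a : K) : (fun _ : T => a) @ F --> a.
Proof. exact: cvg_cst. Qed.

Lemma lim_add c d l m : c @ F --> l -> d @ F --> m ->
  (fun t => c t + d t) @ F --> l + m.
Proof. by move=> cl dm; apply: cvgD. Qed.

Lemma lim_mul c d l m : c @ F --> l -> d @ F --> m ->
  (fun t => c t * d t) @ F --> l * m.
Proof. by move=> cl dm; apply: cvgM. Qed.

Lemma lim_conj c l : c @ F --> l -> (fun t => (c t)^* ) @ F --> l^*.
Proof.
move=> /cvgrPdist_lt cl; apply/cvgrPdist_lt => e /cl.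
by apply: filterS => t; rewrite -rmorphB norm_conjC.
Qed.

Lemma lim_sum (I : Type) (s : seq I) (c : T -> I -> K) (l : I -> K) :
  (forall i, (fun t => c t i) @ F --> l i) ->
  (fun t => \sum_(i <- s) c t i) @ F --> \sum_(i <- s) l i.
Proof.
move=> cl; elim: s => [|i s IH].
  rewrite big_nil; apply: (@lim_ext (fun=> 0)); last exact: lim_cst.
  by move=> t; rewrite big_nil.
rewrite big_cons; apply: (@lim_ext (fun t => c t i + \sum_(j <- s) c t j)).
  by move=> t; rewrite big_cons.
by apply: lim_add; [exact: cl|exact: IH].
Qed.

(** The order of a numeric closed field is only partial; nonnegativity passes to the
    limit because it is the equation expressing that a number is its own norm. *)
Lemma lim_ge0 c l : c @ F --> l -> (\forall t \near F, 0 <= c t) -> 0 <= l.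
Proof.
move=> cl c0; have nl : (fun t => `|c t|) @ F --> (`|l| : K) by exact: cvg_norm.
suff <- : `|l| = l by [].
apply: lim_unique cl; apply: cvg_trans nl; apply: near_eq_cvg.
by apply: filterS c0 => t /= /ger0_norm.
Qed.

End FilterLimits.

End Limits.
Arguments lim_unique {K T F FF c l m}.
Arguments lim_ext {K T F c d l}.
Arguments lim_cst {K T F FF} a.
Arguments lim_add {K T F FF c d l m}.
Arguments lim_mul {K T F FF c d l m}.
Arguments lim_conj {K T F FF c l}.
Arguments lim_ge0 {K T F FF c l}.

Lemma continuous_eq (T U : topologicalType) (f g : T -> U) :
  f =1 g -> continuous f -> continuous g.
Proof. by move=> /funext ->. Qed.

Lemma continuous_conj (K : numClosedFieldType) (T : topologicalType) (f : T -> K) :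
  continuous f -> continuous (fun x => (f x)^* ).
Proof. by move=> cf x; apply: lim_conj; exact: cf. Qed.

Section Complex.
Variable R : realType.
Local Notation C := (Cplx R).
Implicit Types (z : C) (u : nat -> C).

Lemma real_ltC (x y : R) : ((x%:C%C : C) < (y%:C%C : C)) = (x < y).
Proof. exact: ltcR. Qed.

Lemma Re_gt0 z : 0 < z -> 0 < complex.Re z.
Proof. by rewrite [0 < z]ltcE => /andP[]. Qed.

Lemma gt0_ReE z : 0 < z -> z = (complex.Re z)%:C%C.
Proof. by case: z => a b; rewrite [0 < _]ltcE /= => /andP[/eqP -> _]. Qed.

Lemma ge0_ReE z : 0 <= z -> z = (complex.Re z)%:C%C.
Proof. by case: z => a b; rewrite [0 <= _]lecE /= => /andP[/eqP -> _]. Qed.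

Lemma cauchy_real_cvg (u : nat -> R) :
  (forall e, 0 < e -> exists N, forall m n, (N <= m)%N -> (N <= n)%N ->
    `|u m - u n| < e) -> exists l : R, u @ \oo --> l.
Proof.
move=> cu; suff: cvg (u @ \oo) by move=> /cvg_ex[l ul]; exists l.
apply/cauchy_cvgP/cauchy_exP => e e0; have [N HN] := cu e e0.
exists (u N); exists N => // n /= Nn.
by rewrite /ball_/=; exact: HN.
Qed.

Lemma normC_Re z : `|complex.Re z|%:C%C <= `|z| :> C.
Proof. exact: normc_ge_Re. Qed.

Lemma normC_Im z : `|complex.Im z|%:C%C <= `|z| :> C.
Proof.
have := @normc_ge_Re R (z * 'i%C); rewrite normrM ReiNIm normrN.
by rewrite (_ : `|'i%C| = 1 :> R[i]) ?mulr1// normc_def /= expr0n expr1n add0r sqrtr1.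
Qed.

Lemma lim_real_complex (T : Type) (F : set_system T) (FF : Filter F) (v : T -> R)
  (l : R) :
  v @ F --> l -> (fun t => (v t)%:C%C : C) @ F --> (l%:C%C : C).
Proof.
move=> /cvgrPdist_lt vl; apply/cvgrPdist_lt => e e0.
have := vl _ (Re_gt0 e0); apply: filterS => t.
rewrite (_ : (l%:C%C : C) - _ = (l - v t)%:C%C); last by rewrite [RHS]rmorphB.
rewrite [`|_ : C|](_ : _ = `|l - v t|%:C%C :> C); last first.
  by rewrite normc_def /= expr0n addr0 sqrtr_sqr.
by rewrite [e in _ -> _ < e]gt0_ReE// real_ltC.
Qed.

Lemma cauchy_complex_cvg u :
  (forall e : C, 0 < e -> exists N, forall m n, (N <= m)%N -> (N <= n)%N ->
    `|u m - u n| < e) -> exists l : C, u @ \oo --> l.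
Proof.
move=> cu.
have [|a ua] := @cauchy_real_cvg (fun n => complex.Re (u n : R[i]%C)).
  move=> e e0; have [|N HN] := cu e%:C%C; first by rewrite real_ltC.
  exists N => m n Nm Nn; have := HN m n Nm Nn.
  rewrite /= -raddfB -real_ltC; apply: le_lt_trans; exact: normC_Re.
have [|b ub] := @cauchy_real_cvg (fun n => complex.Im (u n : R[i]%C)).
  move=> e e0; have [|N HN] := cu e%:C%C; first by rewrite real_ltC.
  exists N => m n Nm Nn; have := HN m n Nm Nn.
  rewrite /= -raddfB -real_ltC; apply: le_lt_trans; exact: normC_Im.
exists ((a%:C%C : C) + 'i%C * (b%:C%C : C)).
rewrite (_ : u = fun n =>
    ((complex.Re (u n))%:C%C : C) + 'i%C * ((complex.Im (u n))%:C%C : C)).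
  by apply: lim_add; [|apply: lim_mul; [exact: lim_cst|]]; apply: lim_real_complex.
by apply/funext => n; exact: complexE.
Qed.

Lemma exists_natSinv_lt (e : C) : 0 < e -> exists N : nat,
  forall n, (N <= n)%N -> (n.+1%:R)^-1 < e.
Proof.
move=> e0; have := near_infty_natSinv_lt (PosNum (Re_gt0 e0)).
case=> N _ HN; exists N => n Nn; have {HN} := HN n Nn.
rewrite [in X in _ -> X](gt0_ReE e0) -real_ltC /=.
by congr (_ < _); rewrite [LHS]fmorphV rmorph_nat.
Qed.

Lemma lim_expr (z : C) : `|z| < 1 -> (fun n => z ^+ n) @ \oo --> (0 : C).
Proof.
move=> z1; pose r := complex.Re (`|z| : R[i]%C).
have zE : `|z| = r%:C%C by apply: ge0_ReE.
have r0 : 0 <= r.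
  by rewrite -(@ler0c R) -[_%:C%C]zE; exact: normr_ge0.
have r1 : `|r| < 1 by rewrite ger0_norm// -real_ltC -zE.
apply/cvgrPdist_lt => e e0.
have /cvgrPdist_lt/(_ _ (Re_gt0 e0)) := cvg_expr r1.
apply: filterS => n; rewrite !sub0r !normrN !normrX zE ger0_norm//.
rewrite -real_ltC (_ : (_ ^+ n)%:C%C = r%:C%C ^+ n :> C); last exact: rmorphXn.
by rewrite -(gt0_ReE e0).
Qed.

(** A square rather than a disc: as an image of a product of two segments it is
    visibly compact. *)
Definition complex_square (r : R) : set C :=
  (fun p : R * R => 'i%C * (p.2%:C%C : C) + (p.1%:C%C : C)) @`
    (`[- r, r] `*` `[- r, r]).

Lemma complex_square_compact r : compact (complex_square r).
Proof.
apply: continuous_compact; last by apply: compact_setX; exact: segment_compact.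
apply: continuous_subspaceT => p.
apply: lim_add; last by apply: lim_real_complex; exact: cvg_fst.
by apply: lim_mul; [exact: lim_cst|apply: lim_real_complex; exact: cvg_snd].
Qed.

Lemma norm_complex_square r (z : C) : `|z| <= r%:C%C -> complex_square r z.
Proof.
move=> zr; exists (complex.Re (z : R[i]%C), complex.Im (z : R[i]%C)).
  split; rewrite /= in_itv /= -ler_norml -(@lecR R); apply: le_trans zr.
    exact: normC_Re.
  exact: normC_Im.
by rewrite /= addrC; apply/esym; exact: complexE.
Qed.

End Complex.

(** * Hilbert spaces *)

Section CauchySchwarz.
Variable C : numClosedFieldType.

(** For a positive form, this is Cauchy-Schwarz with [n = `|f x y| ^+ 2]: the
    hypothesis is the positivity of the form at [x - s * f x y *: y]. It is stated on
    numbers so as to serve also for forms which are not definite, and for almost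
    minimal distances. *)
Lemma sesqui_discriminant (a b n : C) : 0 <= a -> 0 <= b -> 0 <= n ->
  (forall s : C, 0 <= s -> 0 <= a - 2 * s * n + s ^+ 2 * n * b) ->
  n <= a * b.
Proof.
move=> a0 b0 n0 H; have [b_eq0|bN0] := eqVneq b 0; last first.
  have bp : 0 < b by rewrite lt_def bN0.
  have := H b^-1; rewrite invr_ge0 => /(_ b0).
  have -> : a - 2 * b^-1 * n + b^-1 ^+ 2 * n * b = a - n / b by field.
  by rewrite subr_ge0 ler_pdivrMr.
have [->|nN0] := eqVneq n 0; first by rewrite mulr_ge0.
have np : 0 < n by rewrite lt_def nN0.
(* The polynomial is affine in s; any s beyond a / (2 n) makes it negative. *)
have s0 : 0 <= (a + 1) / n by rewrite divr_ge0// addr_ge0.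
have := H _ s0.
have -> : a - 2 * ((a + 1) / n) * n + ((a + 1) / n) ^+ 2 * n * b = - (a + 2).
  by rewrite b_eq0; field.
rewrite oppr_ge0 => h; have : 0 < a + 2 by rewrite ltr_wpDl.
by move=> /lt_le_trans /(_ h); rewrite ltxx.
Qed.

Lemma dot_CauchySchwarz (U : lmodType C) (f : {dot U for @Num.conj C}) x y :
  `|f x y| ^+ 2 <= f x x * f y y.
Proof.
apply: sesqui_discriminant; rewrite ?dnorm_ge0 ?exprn_ge0// => s s0.
have := dnorm_ge0 f (x - (s * f x y) *: y).
rewrite dnormB dnormZ linearZr_LR /=.
rewrite !rmorphM /= !conjCK normrM exprMn (ger0_norm s0) normCK.
rewrite (geC0_conj s0) => h; apply: le_trans h _.
by rewrite le_eqVlt; apply/orP; left; apply/eqP; ring.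
Qed.

Lemma dot_triangle (U : lmodType C) (f : {dot U for @Num.conj C}) x y :
  sqrtC (f (x + y) (x + y)) <= sqrtC (f x x) + sqrtC (f y y).
Proof.
rewrite -(@ler_pXn2r _ 2)// ?nnegrE ?addr_ge0 ?sqrtC_ge0 ?dnorm_ge0//.
rewrite sqrrD !sqrtCK dnormD addrAC lerD2r lerD2l.
apply: le_trans (_ : `|f x y + (f x y)^*| <= _).
  by apply: real_ler_norm; rewrite CrealE rmorphD /= conjCK addrC.
apply: le_trans (ler_normD _ _) _; rewrite norm_conjC -mulr2n lerMn2r /=.
rewrite -(@ler_pXn2r _ 2)// ?nnegrE ?mulr_ge0 ?sqrtC_ge0 ?dnorm_ge0//.
by rewrite exprMn !sqrtCK dot_CauchySchwarz.
Qed.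

Lemma dot_sqrtZ (U : lmodType C) (f : {dot U for @Num.conj C}) (a : C) x :
  sqrtC (f (a *: x) (a *: x)) = `|a| * sqrtC (f x x).
Proof. by rewrite dnormZ rootCMl ?exprn_ge0// sqrCK. Qed.

End CauchySchwarz.

Section HilbertSpace.
Variables (R : realType) (H : hilbertType R).
Local Notation C := (Cplx R).
Implicit Types (x y z : H) (M : set H).

Lemma ip_conj x y : (ip x y)^* = ip y x.
Proof. by rewrite [RHS]hermC expr0 mul1r. Qed.

Lemma ipDl x y z : ip (x + y) z = ip x z + ip y z. Proof. exact: linearDl. Qed.
Lemma ipBl x y z : ip (x - y) z = ip x z - ip y z. Proof. exact: linearBl. Qed.
Lemma ipZl (a : C) x z : ip (a *: x) z = a * ip x z. Proof. exact: linearZl_LR. Qed.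
Lemma ipDr x y z : ip z (x + y) = ip z x + ip z y. Proof. exact: linearDr. Qed.
Lemma ipBr x y z : ip z (x - y) = ip z x - ip z y. Proof. exact: linearBr. Qed.
Lemma ipZr (a : C) x z : ip z (a *: x) = a^* * ip z x. Proof. exact: linearZr_LR. Qed.

Lemma ip0l x : ip 0 x = 0 :> C. Proof. exact: linear0l. Qed.
Lemma ip0r x : ip x 0 = 0 :> C. Proof. exact: linear0r. Qed.
Lemma ip_suml (I : Type) (l : seq I) (F : I -> H) x :
  ip (\sum_(i <- l) F i) x = \sum_(i <- l) ip (F i) x :> C.
Proof. exact: linear_sumlz. Qed.
Lemma ip_sumr (I : Type) (l : seq I) (F : I -> H) x :
  ip x (\sum_(i <- l) F i) = \sum_(i <- l) ip x (F i) :> C.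
Proof. exact: linear_sumr. Qed.

Lemma ip_CauchySchwarz x y : `|ip x y| <= `|x| * `|y|.
Proof.
rewrite -(@ler_pXn2r _ 2)// ?nnegrE ?mulr_ge0//.
by rewrite exprMn -!ip_norm; exact: dot_CauchySchwarz.
Qed.

Lemma ip_norm_eq x y :
  ip x x = ip y y -> `|x| = `|y|.
Proof. by rewrite !ip_norm => /eqP; rewrite eqrXn2// => /eqP. Qed.

Lemma ip_inj x y : (forall z, ip x z = ip y z) -> x = y.
Proof.
move=> h; apply/eqP; rewrite -subr_eq0 -normr_eq0 -sqrf_eq0 -ip_norm ipBl h.
by rewrite subrr.
Qed.

Lemma hilbert_cauchy_cvg (u : nat -> H) :
  (forall e : C, 0 < e -> exists N, forall m n, (N <= m)%N -> (N <= n)%N ->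
    `|u m - u n| < e) -> exists l : H, u @ \oo --> l.
Proof.
move=> cu; suff: cvg (u @ \oo) by move=> /cvg_ex[l ul]; exists l.
apply/cauchy_cvgP/cauchy_exP => e e0; have [N HN] := cu e e0.
by exists (u N); exists N => // n /= Nn; rewrite -ball_normE /=; exact: HN.
Qed.

(** Closedness is expressed by approximation, the form in which it is proved and used
    for sets defined by conditions on coefficients. *)
Definition closed_subspace M := [/\ M 0,
  forall (a : C) x y, M x -> M y -> M (a *: x + y)
  & forall x, (forall e : C, 0 < e -> exists2 y, M y & `|x - y| < e) -> M x].

Lemma closed_subspaceB M x y : closed_subspace M -> M x -> M y -> M (x - y).
Proof.
by case=> _ lM _ Mx My; rewrite addrC -scaleN1r; exact: lM.
Qed.

(** A vector of [M] whose squared distance to [x] exceeds the infimum by less than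
    [e ^+ 2] is almost orthogonal to [M]: moving along [z] could decrease the squared
    distance by at most [e ^+ 2]. *)
Lemma almost_projection M x (e : C) : closed_subspace M -> 0 < e ->
  exists2 z0, M z0 & forall z, M z -> `|ip (x - z0) z| <= e * `|z|.
Proof.
move=> cM e0; have [M0 lM _] := cM.
pose S := [set r : R | exists2 z, M z & r%:C%C = `|x - z| ^+ 2 :> C].
have SE z : M z -> S (complex.Re (`|x - z| ^+ 2 : R[i]%C)).
  by move=> Mz; exists z => //; rewrite -ge0_ReE// exprn_ge0.
have infS : has_inf S.
  split; first by exists (complex.Re (`|x - 0| ^+ 2 : R[i]%C)); exact: SE.
  exists 0 => r [z _ rE].
  have : 0 <= (r%:C%C : C) by rewrite rE exprn_ge0.
  by rewrite [0 <= _]ler0c.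
have ee0 : 0 < complex.Re (e ^+ 2 : R[i]%C) by apply: Re_gt0; rewrite exprn_gt0.
have [r [z0 Mz0 rE] rlt] := inf_adherent ee0 infS.
have {rlt} rlt : `|x - z0| ^+ 2 < ((inf S)%:C%C : C) + e ^+ 2.
  have -> : e ^+ 2 = (complex.Re (e ^+ 2 : R[i]%C))%:C%C.
    by apply: gt0_ReE; rewrite exprn_gt0.
  by rewrite -rE -[X in _ < X]rmorphD real_ltC.
have dle z : M z -> ((inf S)%:C%C : C) <= `|x - z| ^+ 2.
  move=> Mz; have -> : `|x - z| ^+ 2 = (complex.Re (`|x - z| ^+ 2 : R[i]%C))%:C%C.
    by apply: ge0_ReE; rewrite exprn_ge0.
  by rewrite [_ <= _]lecR; apply: ge_inf; [case: infS|exact: SE].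
exists z0 => // z Mz; have ege0 := ltW e0.
rewrite -(@ler_pXn2r _ 2)// ?nnegrE ?mulr_ge0//.
rewrite exprMn -ip_norm.
apply: (@le_trans _ _ ((`|x - z0| ^+ 2 - ((inf S)%:C%C : C)) * ip z z)); last first.
  by rewrite ler_wpM2r// ?dnorm_ge0// lerBlDl ltW.
apply: sesqui_discriminant; rewrite ?dnorm_ge0 ?exprn_ge0//.
  by rewrite subr_ge0 dle.
move=> s s0; have := dle ((s * ip (x - z0) z) *: z + z0) (lM _ _ _ Mz Mz0).
rewrite -subr_ge0 opprD addrCA addrC -ip_norm dnormB dnormZ ipZr.
rewrite !rmorphM /= !conjCK normrM exprMn (ger0_norm s0) normCK.
rewrite (geC0_conj s0) => h; apply: le_trans h _.
by rewrite le_eqVlt -ip_norm; apply/orP; left; apply/eqP; ring.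
Qed.

End HilbertSpace.

Section HilbertOperators.
Variable (R : realType).
Local Notation C := (Cplx R).

Variable (H : hilbertType R).
Implicit Types (x y z : H) (M : set H).

(** Almost orthogonal projections up to [1 / (n + 1)] form a Cauchy sequence, because
    the difference of two of them lies in [M], to which both are almost orthogonal. *)
Lemma projection_exists M x : closed_subspace M ->
  exists2 m, M m & forall z, M z -> ip (x - m) z = 0.
Proof.
move=> cM; have [_ _ clM] := cM.
have en0 n : 0 < (n.+1%:R)^-1 :> C by rewrite invr_gt0.
have /choice[u uP] n : exists z0, M z0 /\
    forall z, M z -> `|ip (x - z0) z| <= n.+1%:R^-1 * `|z|.
  by have [z0 ? ?] := almost_projection x cM (en0 n); exists z0.
have Mu n := (uP n).1.
have ucauchy m n : `|u m - u n| <= m.+1%:R^-1 + n.+1%:R^-1.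
  have Mmn := closed_subspaceB cM (Mu m) (Mu n).
  have [->|mn0] := eqVneq (u m - u n) 0.
    by rewrite normr0 addr_ge0// ltW.
  have mnp : 0 < `|u m - u n| by rewrite normr_gt0.
  rewrite -(ler_pM2r mnp) -expr2 -ip_norm -[leLHS]ger0_norm ?dnorm_ge0//.
  have -> : ip (u m - u n) (u m - u n) =
      ip (x - u n) (u m - u n) - ip (x - u m) (u m - u n).
    by rewrite -ipBl; congr (ip _ _); rewrite opprB [RHS]addrC subrKA.
  apply: le_trans (ler_normB _ _) _.
  by rewrite addrC mulrDl lerD// (uP _).2.
have [m um] : exists l : H, u @ \oo --> l.
  apply: hilbert_cauchy_cvg => e e0.
  have e20 : 0 < e / 2 by rewrite divr_gt0.
  have [N HN] := exists_natSinv_lt e20; exists N => m n Nm Nn.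
  by rewrite (le_lt_trans (ucauchy m n))// (splitr e) ltrD// HN.
move/cvgrPdist_lt in um.
exists m.
  apply: clM => e e0; have [N _ HN] := um e e0.
  by exists (u N) => //; exact: HN (leqnn N).
move=> z Mz; apply: norm_small_eq0 => e e0.
pose d := e / 2 / (`|z| + 1).
have z1 : 0 < `|z| + 1 by rewrite ltr_wpDl.
have d0 : 0 < d by rewrite !divr_gt0.
have [N1 _ HN1] := um d d0; have [N2 HN2] := exists_natSinv_lt d0.
pose n := maxn N1 N2.
rewrite -(subrKA (u n)) ipDl.
apply: le_trans (ler_normD _ _) _.
have dz : d * `|z| <= e / 2.
  by rewrite /d mulrAC ler_pdivrMr// ler_wpM2l ?lerDl// ltW// divr_gt0.
rewrite (splitr e) lerD//; apply: le_trans dz.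
  apply: le_trans ((uP n).2 z Mz) _; rewrite ler_wpM2r// ltW//.
  by apply: HN2; exact: leq_maxr.
apply: le_trans (ip_CauchySchwarz _ _) _; rewrite ler_wpM2r// ltW//.
by rewrite distrC; apply: HN1; exact: leq_maxl.
Qed.

(** The representing vector is orthogonal to the kernel of [f], which is a closed
    hyperplane. *)
Lemma Riesz (f : H -> C) :
  (forall (a : C) x y, f (a *: x + y) = a * f x + f y) ->
  (forall e : C, 0 < e -> exists2 d : C, 0 < d & forall x, `|x| < d -> `|f x| < e) ->
  exists y, forall x, f x = ip x y.
Proof.
move=> flin fcont.
have f0 : f 0 = 0.
  by have := flin (-1) 0 0; rewrite scaler0 addr0 mulN1r addNr.
have fB x y : f (x - y) = f x - f y.
  by rewrite addrC -scaleN1r flin mulN1r addrC.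
have [fz|] := pselect (forall x, f x = 0).
  by exists 0 => x; rewrite fz linear0r.
move=> /existsNP[x0 /eqP fx0].
pose M := [set x | f x = 0].
have cM : closed_subspace M.
  split => //.
  - by move=> a x y; rewrite /M/= => fx fy; rewrite flin fx fy mulr0 addr0.
  - move=> x hx; rewrite /M/=; apply: norm_small_eq0 => e /fcont[d d0 fd].
    have [y fy /fd] := hx d d0; rewrite fB fy subr0; exact: ltW.
have [m fm mP] := projection_exists x0 cM.
set w := x0 - m in mP.
have fw : f w = f x0 by rewrite fB fm subr0.
have w0 : ip w w != 0.
  rewrite dnorm_eq0; apply: contra_neq fx0 => w0.
  by rewrite -fw w0.
exists ((f w / ip w w)^* *: w) => x.
have /mP : M (f w *: x - f x *: w).
  by rewrite /M/= -scaleNr addrC flin -[_ *: x]addr0 flin f0; ring.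
rewrite ipBr !ipZr => /eqP; rewrite subr_eq0 => /eqP h.
rewrite conjCK.
have {h} : (f w)^*^* * (ip w x)^* = (f x)^*^* * (ip w w)^*.
  by rewrite -!rmorphM h.
by rewrite !conjCK !ip_conj mulrAC => ->; rewrite mulfK.
Qed.

Lemma Riesz_sesquilinear (B : H -> H -> C) :
  (forall (a : C) x y z, B (a *: x + y) z = a * B x z + B y z) ->
  (forall (a : C) x y z, B z (a *: x + y) = a^* * B z x + B z y) ->
  (forall x y, `|B x y| <= `|x| * `|y|) ->
  exists T : H -> H, [/\ linear T, forall x, `|T x| <= `|x| &
    forall x y, B x y = ip (T x) y].
Proof.
move=> linB clinB Bb.
have /choice[T TP] x : exists t, forall y, B x y = ip t y.
  have [|e e0|t tP] := @Riesz (fun y => (B x y)^* ).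
  - by move=> a y z; rewrite clinB rmorphD rmorphM /= conjCK.
  - have x1 : 0 < `|x| + 1 by rewrite ltr_wpDl.
    exists (e / (`|x| + 1)); first by rewrite divr_gt0.
    move=> y; rewrite ltr_pdivlMr// norm_conjC; apply: le_lt_trans.
    by apply: le_trans (Bb _ _) _; rewrite mulrC ler_wpM2l// lerDl.
  - by exists t => y; rewrite -[LHS]conjCK tP ip_conj.
exists T; split => //.
  by move=> a x y; apply: ip_inj => z; rewrite -TP linB ipDl ipZl !TP.
move=> x; have [->|Tx0] := eqVneq (T x) 0; first by rewrite normr0.
have Txp : 0 < `|T x| by rewrite normr_gt0.
rewrite -(ler_pM2r Txp) -expr2 -ip_norm -TP -[leLHS]ger0_norm ?Bb//.
by rewrite TP dnorm_ge0.
Qed.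

Lemma contraction_bounded_ops (T : H -> H) :
  linear T -> (forall x, `|T x| <= `|x|) -> bounded_ops T.
Proof.
move=> linT Tle; split=> // x; apply/cvgrPdist_lt => e e0.
have TB z : T x - T z = T (x - z).
  by rewrite addrC -scaleN1r -linT scaleN1r addrC.
near=> z; rewrite TB; apply: le_lt_trans (Tle _) _.
near: z; have := @cvg_id _ (nbhs x).
by move=> /cvgrPdist_lt /(_ e e0).
Unshelve. all: by end_near. Qed.

(** Membership in a von Neumann algebra is tested on commutants, whose elements are
    arbitrary bounded operators: moving them across the inner product requires their
    adjoints. *)
Lemma adjoint_exists (T : H -> H) : bounded_ops T -> exists S, adjoint T S.
Proof.
move=> [linT cT].
have T0 : T 0 = 0 by have := linT (-1) 0 0; rewrite scaler0 addr0 scaleN1r addNr.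
suff /choice[S SP] y : exists t, forall x, ip (T x) y = ip x t by exists S.
have [||t tP] := @Riesz (fun x => ip (T x) y).
- by move=> a x z; rewrite linT ipDl ipZl.
- move=> e e0; have y1 : 0 < `|y| + 1 by rewrite ltr_wpDl.
  have /cvgrPdist_lt/(_ _ (divr_gt0 e0 y1)) := cT 0.
  rewrite T0 => /nbhs_ballP[d /= d0 hd]; exists d => // x xd.
  have := hd x; rewrite -ball_normE /= !sub0r !normrN => /(_ xd).
  rewrite ltr_pdivlMr//; apply: le_lt_trans.
  by apply: le_trans (ip_CauchySchwarz _ _) _; rewrite ler_wpM2l// lerDl.
- by exists t.
Qed.

End HilbertOperators.

(** Continuity of a representation needs to be verified on generating vectors only:
    the isometries [U s] are uniformly bounded, so that an approximation of [x] gives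
    one of [U s x], uniformly in [s]. *)
Lemma strong_continuity_closed (R : realType) (H : hilbertType R) (T : topologicalType)
    (U : T -> H -> H) :
  (forall s, linear (U s)) -> (forall s x, `|U s x| = `|x|) ->
  closed_subspace [set x | forall e : Cplx R, 0 < e ->
    forall s, \forall t \near s, `|U s x - U t x| < e].
Proof.
move=> linU normU.
have UB s x y : U s (x - y) = U s x - U s y.
  by rewrite addrC -scaleN1r linU scaleN1r addrC.
split.
- move=> d d0 s; near=> t.
  have U0 r : U r 0 = 0 by have := UB r 0 0; rewrite !subrr.
  by rewrite !U0 subrr normr0.
- move=> a x y Mx My d d0 s.
  have a1 : 0 < `|a| + 1 by rewrite ltr_wpDl.
  have := Mx _ (divr_gt0 (divr_gt0 d0 (ltr0Sn _ 1)) a1) s.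
  have := My _ (divr_gt0 d0 (ltr0Sn _ 1)) s.
  apply: filterS2 => t yt xt; rewrite !linU.
  rewrite opprD addrACA -scalerBr (splitr d).
  apply: le_lt_trans (ler_normD _ _) _; rewrite ltrD// normrZ.
  move: xt; rewrite ltr_pdivlMr//; apply: le_lt_trans.
  by rewrite mulrC ler_wpM2l// lerDl.
move=> x hx d d0 s.
have d30 : 0 < d / 2 / 2 by rewrite !divr_gt0.
have [y My xy] := hx _ d30.
have := My _ (divr_gt0 d0 (ltr0Sn _ 1)) s.
apply: filterS => t yt.
have -> : U s x - U t x = (U s y - U t y) + (U s (x - y) - U t (x - y)).
  have E r : U r x = U r y + U r (x - y) by rewrite UB addrC subrK.
  by rewrite (E s) (E t) opprD addrACA.
apply: le_lt_trans (ler_normD _ _) _; rewrite (splitr d) ltrD//.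
apply: le_lt_trans (ler_normB _ _) _; rewrite !normU.
by rewrite (splitr (d / 2)) ltrD.
Unshelve. all: by end_near. Qed.

Section Projections.
Variables (R : realType) (H : hilbertType R) (K : set H).
Local Notation C := (Cplx R).
Hypothesis cK : closed_subspace K.

Lemma projection_operator : exists P : H -> H,
  (forall x, K (P x)) /\ forall x z, K z -> ip (x - P x) z = 0.
Proof.
have /choice[P PP] x : exists m, K m /\ forall z, K z -> ip (x - m) z = 0.
  by have [m Km mP] := projection_exists x cK; exists m.
by exists P; split=> x; case: (PP x).
Qed.

Variable P : H -> H.
Hypothesis PK : forall x, K (P x).
Hypothesis Porth : forall x z, K z -> ip (x - P x) z = 0.

Lemma projection_unique x m : K m -> (forall z, K z -> ip (x - m) z = 0) -> P x = m.
Proof.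
move=> Km mP; have Kw := closed_subspaceB cK (PK x) Km.
apply/eqP; rewrite -subr_eq0 -(dnorm_eq0 (@ip R H)); apply/eqP.
rewrite -{1}[P x](subrK x) -addrA ipDl mP// -opprB -scaleN1r ipZl Porth//.
by rewrite mulr0 add0r.
Qed.

Lemma projection_id x : K x -> P x = x.
Proof. by move=> Kx; apply: projection_unique => // z _; rewrite subrr ip0l. Qed.

Lemma projection_linear : linear P.
Proof.
move=> a x y; have [_ lK _] := cK.
apply: projection_unique; first exact: lK.
move=> z Kz; rewrite opprD addrACA -scalerBr ipDl ipZl.
by rewrite !Porth// mulr0 addr0.
Qed.

Lemma projection_norm x : `|P x| <= `|x|.
Proof.
have [->|Px0] := eqVneq (P x) 0; first by rewrite normr0.
have Pxp : 0 < `|P x| by rewrite normr_gt0.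
rewrite -(ler_pM2r Pxp) -expr2 -ip_norm.
have -> : ip (P x) (P x) = ip x (P x).
  by apply/eqP; rewrite eq_sym -subr_eq0 -ipBl Porth.
rewrite -[leLHS]ger0_norm ?ip_CauchySchwarz//.
have /eqP := Porth x (PK x); rewrite ipBl subr_eq0 => /eqP ->.
exact: dnorm_ge0.
Qed.

Lemma projection_preimage M : closed_subspace M -> closed_subspace [set x | M (P x)].
Proof.
move=> [M0 lM clM]; have P0 : P 0 = 0 by apply: projection_id; case: cK.
split=> [|a x y Mx My|x hx]; first by rewrite /= P0.
  by rewrite /= projection_linear; exact: lM.
rewrite /=; apply: clM => e /hx[y My xy]; exists (P y) => //.
have -> : P x - P y = P (x - y).
  by rewrite addrC -scaleN1r -projection_linear scaleN1r addrC.
exact: le_lt_trans (projection_norm _) xy.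
Qed.

End Projections.

(** * Reproducing kernel Hilbert spaces *)

Section PositiveKernel.
Variables (R : realType) (X : Type).
Local Notation C := (Cplx R).
Implicit Types (K : X -> X -> C) (v w : seq (C * X)) (u : nat -> seq (C * X)).

(** A list of pairs stands for the combination of the functions [K y], each with its
    coefficient. Lists may repeat points and several lists may define the same
    function; [form_eval] is what makes the form depend on the functions only. *)
Definition comb_eval K v : X -> C := fun x => \sum_(p <- v) p.1 * K p.2 x.

Definition comb_form K v w : C := \sum_(q <- w) q.1^* * comb_eval K v q.2.

Definition psd_kernel K :=
  (forall x y, K y x = (K x y)^*) /\ forall v, 0 <= comb_form K v v.

Definition comb_scale (a : C) v := [seq (a * p.1, p.2) | p <- v].
Definition comb_sub v w := v ++ comb_scale (-1) w.

Variable K : X -> X -> C.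
Local Notation ev := (comb_eval K).
Local Notation frm := (comb_form K).

Lemma eval_cat v w x : ev (v ++ w) x = ev v x + ev w x.
Proof. by rewrite /comb_eval big_cat. Qed.

Lemma eval_scale a v x : ev (comb_scale a v) x = a * ev v x.
Proof.
by rewrite /comb_eval big_map mulr_sumr; apply: eq_bigr => p _; rewrite mulrA.
Qed.

Lemma eval_sub v w x : ev (comb_sub v w) x = ev v x - ev w x.
Proof. by rewrite eval_cat eval_scale mulN1r. Qed.

Lemma eval_one x y : ev [:: (1, x)] y = K x y.
Proof. by rewrite /comb_eval big_seq1 mul1r. Qed.

Lemma form_catr v w w' : frm v (w ++ w') = frm v w + frm v w'.
Proof. by rewrite /comb_form big_cat. Qed.

Lemma form_scaler v a w : frm v (comb_scale a w) = a^* * frm v w.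
Proof.
rewrite /comb_form big_map mulr_sumr; apply: eq_bigr => p _.
by rewrite rmorphM mulrA.
Qed.

Lemma form_subr v w w' : frm v (comb_sub w w') = frm v w - frm v w'.
Proof. by rewrite form_catr form_scaler rmorphN1 mulN1r. Qed.

Lemma form_one v x : frm v [:: (1, x)] = ev v x.
Proof. by rewrite /comb_form big_seq1 rmorph1 mul1r. Qed.

Hypothesis Kpsd : psd_kernel K.

Lemma form_conj v w : (frm v w)^* = frm w v.
Proof.
rewrite /comb_form /comb_eval rmorph_sum /=.
under eq_bigr do rewrite rmorphM /= conjCK rmorph_sum /= mulr_sumr.
rewrite exchange_big /=; apply: eq_bigr => p _.
rewrite mulr_sumr; apply: eq_bigr => q _.
by rewrite rmorphM /= -Kpsd.1 mulrCA.
Qed.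

Lemma form_evall v v' w : ev v =1 ev v' -> frm v w = frm v' w.
Proof. by move=> e; apply: eq_bigr => q _; rewrite e. Qed.

Lemma form_eval v v' w w' : ev v =1 ev v' -> ev w =1 ev w' ->
  frm v w = frm v' w'.
Proof.
move=> e e'; rewrite (form_evall _ e) -form_conj (form_evall _ e').
by rewrite form_conj.
Qed.

Lemma form_catl v v' w : frm (v ++ v') w = frm v w + frm v' w.
Proof. by rewrite -form_conj form_catr rmorphD /= !form_conj. Qed.

Lemma form_scalel a v w : frm (comb_scale a v) w = a * frm v w.
Proof. by rewrite -form_conj form_scaler rmorphM /= conjCK form_conj. Qed.

Lemma form_subl v v' w : frm (comb_sub v v') w = frm v w - frm v' w.
Proof. by rewrite -form_conj form_subr rmorphB /= !form_conj. Qed.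

Definition comb_norm v : C := sqrtC (frm v v).
Local Notation nrm := comb_norm.

Lemma comb_norm_ge0 v : 0 <= nrm v.
Proof. by rewrite sqrtC_ge0 Kpsd.2. Qed.
Local Hint Resolve comb_norm_ge0 : core.

Lemma sqr_comb_norm v : nrm v ^+ 2 = frm v v.
Proof. exact: sqrtCK. Qed.

Lemma comb_norm_eval v v' : ev v =1 ev v' -> nrm v = nrm v'.
Proof. by move=> e; rewrite /comb_norm (form_eval e e). Qed.

Lemma comb_CauchySchwarz v w : `|frm v w| <= nrm v * nrm w.
Proof.
rewrite -(@ler_pXn2r _ 2)// ?nnegrE ?mulr_ge0//.
rewrite exprMn !sqr_comb_norm.
apply: sesqui_discriminant; rewrite ?exprn_ge0 ?Kpsd.2// => s s0.
have := Kpsd.2 (comb_sub v (comb_scale (s * frm v w) w)).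
rewrite form_subl !form_subr !form_scalel !form_scaler rmorphM /= form_conj.
rewrite (geC0_conj s0) => h; apply: le_trans h _.
rewrite le_eqVlt; apply/orP; left; apply/eqP.
by rewrite normCK form_conj; ring.
Qed.

Lemma comb_norm_cat v w : nrm (v ++ w) <= nrm v + nrm w.
Proof.
rewrite -(@ler_pXn2r _ 2)// ?nnegrE ?addr_ge0//.
rewrite sqrrD !sqr_comb_norm form_catl !form_catr.
rewrite addrA lerD2r -!addrA lerD2l.
rewrite -[frm w v]form_conj.
apply: le_trans (_ : `|frm v w + (frm v w)^*| <= _).
  by apply: real_ler_norm; rewrite CrealE rmorphD /= conjCK addrC.
apply: le_trans (ler_normD _ _) _; rewrite norm_conjC mulr2n.
by rewrite lerD ?comb_CauchySchwarz.
Qed.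

Lemma comb_norm_scale a v : nrm (comb_scale a v) = `|a| * nrm v.
Proof.
rewrite /comb_norm form_scalel form_scaler mulrA -normCK rootCMl ?exprn_ge0//.
by rewrite sqrCK.
Qed.

End PositiveKernel.

Section CauchyCombinations.
Variables (R : realType) (X : Type).
Local Notation C := (Cplx R).
Variables (K : X -> X -> C) (Kpsd : psd_kernel K).
Implicit Types (v : seq (C * X)) (u w : nat -> seq (C * X)) (f g : X -> C).
Local Notation ev := (comb_eval K).
Local Notation frm := (comb_form K).
Local Notation nrm := (comb_norm K).

Definition comb_cauchy u := forall e : C, 0 < e -> exists N, forall m n,
  (N <= m)%N -> (N <= n)%N -> nrm (comb_sub (u m) (u n)) < e.

Lemma comb_cauchy_bounded u : comb_cauchy u ->
  exists2 B : C, 0 < B & exists N, forall n, (N <= n)%N -> nrm (u n) <= B.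
Proof.
move=> cu; have [N HN] := cu 1 ltr01.
exists (1 + nrm (u N)); first by rewrite ltr_wpDr// comb_norm_ge0.
exists N => n Nn.
rewrite (@comb_norm_eval _ _ _ Kpsd _ (comb_sub (u n) (u N) ++ u N)); last first.
  by move=> x; rewrite eval_cat eval_sub subrK.
by apply: le_trans (comb_norm_cat Kpsd _ _) _; rewrite lerD2r ltW// HN.
Qed.

Lemma comb_form_cvg u w : comb_cauchy u -> comb_cauchy w ->
  exists l : C, (fun n => frm (u n) (w n)) @ \oo --> l.
Proof.
move=> cu cw.
have [B1 B10 [N1 HN1]] := comb_cauchy_bounded cu.
have [B2 B20 [N2 HN2]] := comb_cauchy_bounded cw.
apply: cauchy_complex_cvg => e e0.
have [N3 HN3] := cu (e / 2 / B2) (divr_gt0 (divr_gt0 e0 (ltr0Sn _ 1)) B20).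
have [N4 HN4] := cw (e / 2 / B1) (divr_gt0 (divr_gt0 e0 (ltr0Sn _ 1)) B10).
exists (maxn (maxn N1 N2) (maxn N3 N4)) => m n.
rewrite !geq_max => /andP[/andP[m1 m2] /andP[m3 m4]] /andP[/andP[n1 n2] /andP[n3 n4]].
have -> : frm (u m) (w m) - frm (u n) (w n) =
    frm (comb_sub (u m) (u n)) (w m) + frm (u n) (comb_sub (w m) (w n)).
  by rewrite form_subl// form_subr addrA subrK.
apply: le_lt_trans (ler_normD _ _) _; rewrite (splitr e).
have d1 := HN3 _ _ m3 n3; have d2 := HN4 _ _ m4 n4.
apply: ltrD.
  apply: le_lt_trans (comb_CauchySchwarz Kpsd _ _) _.
  apply: (@le_lt_trans _ _ (nrm (comb_sub (u m) (u n)) * B2)).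
    by rewrite ler_wpM2l ?comb_norm_ge0// HN2.
  by rewrite -ltr_pdivlMr.
apply: le_lt_trans (comb_CauchySchwarz Kpsd _ _) _.
apply: (@le_lt_trans _ _ (B1 * nrm (comb_sub (w m) (w n)))).
  by rewrite ler_wpM2r ?comb_norm_ge0// HN1.
by rewrite mulrC -ltr_pdivlMr.
Qed.

(** A reproducing kernel space embeds into functions because of this fact: pointwise
    convergence to zero, together with the Cauchy condition, forces the limit vector
    to be zero. Pointwise values are the products with generators, so the form tends
    to zero against each fixed combination, and the Cauchy condition on [w] makes this
    uniform. *)
Lemma comb_form_cvg0 u w : comb_cauchy u -> comb_cauchy w ->
  (forall x, (fun n => ev (u n) x) @ \oo --> (0 : C)) ->
  (fun n => frm (u n) (w n)) @ \oo --> (0 : C).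
Proof.
move=> cu cw u0.
have [B B0 [N1 HN1]] := comb_cauchy_bounded cu.
have fixed v : (fun n => frm (u n) v) @ \oo --> (0 : C).
  rewrite /comb_form; elim: v => [|q v IH].
    by apply: (lim_ext _ (lim_cst 0)) => n; rewrite big_nil.
  pose proof (lim_add (lim_mul (lim_cst q.1^*) (u0 q.2)) IH) as h; move: h.
  by rewrite mulr0 addr0; apply: lim_ext => n; rewrite big_cons.
apply/cvgrPdist_lt => e e0.
have [N2 HN2] := cw (e / 2 / B) (divr_gt0 (divr_gt0 e0 (ltr0Sn _ 1)) B0).
have /cvgrPdist_lt/(_ _ (divr_gt0 e0 (ltr0Sn _ 1)))[N3 _ HN3] := fixed (w N2).
exists (maxn N1 (maxn N2 N3)) => // n /=.
rewrite !geq_max => /and3P[n1 n2 n3].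
have -> : frm (u n) (w n) = frm (u n) (w N2) + frm (u n) (comb_sub (w n) (w N2)).
  by rewrite form_subr addrC subrK.
rewrite opprD addrA; apply: le_lt_trans (ler_normB _ _) _; rewrite (splitr e).
apply: ltrD; first exact: HN3.
apply: le_lt_trans (comb_CauchySchwarz Kpsd _ _) _.
apply: (@le_lt_trans _ _ (B * nrm (comb_sub (w n) (w N2)))).
  by rewrite ler_wpM2r ?comb_norm_ge0// HN1.
by rewrite mulrC -ltr_pdivlMr// HN2.
Qed.

Definition comb_lim u f :=
  comb_cauchy u /\ forall x, (fun n => ev (u n) x) @ \oo --> f x.

Lemma comb_lim_scale_add (a : C) u w f g : comb_lim u f -> comb_lim w g ->
  comb_lim (fun n => comb_scale a (u n) ++ w n) (fun x => a * f x + g x).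
Proof.
move=> [cu uf] [cw wg]; split; last first.
  move=> x; apply: (lim_ext _ (lim_add (lim_mul (lim_cst a) (uf x)) (wg x))) => n.
  by rewrite eval_cat eval_scale.
move=> e e0; have a1 : 0 < `|a| + 1 by rewrite ltr_wpDl.
have [N1 HN1] := cu (e / 2 / (`|a| + 1)) (divr_gt0 (divr_gt0 e0 (ltr0Sn _ 1)) a1).
have [N2 HN2] := cw (e / 2) (divr_gt0 e0 (ltr0Sn _ 1)).
exists (maxn N1 N2) => m n; rewrite !geq_max => /andP[m1 m2] /andP[n1 n2].
rewrite (@comb_norm_eval _ _ _ Kpsd _
  (comb_scale a (comb_sub (u m) (u n)) ++ comb_sub (w m) (w n))); last first.
  by move=> x; rewrite !(eval_sub, eval_cat, eval_scale); ring.
apply: le_lt_trans (comb_norm_cat Kpsd _ _) _; rewrite (splitr e).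
apply: ltrD; last exact: HN2.
rewrite comb_norm_scale//.
have := HN1 _ _ m1 n1; rewrite ltr_pdivlMr//; apply: le_lt_trans.
by rewrite mulrC ler_wpM2l ?comb_norm_ge0// lerDl.
Qed.

Lemma comb_lim_cst v : comb_lim (fun=> v) (ev v).
Proof.
split; last by move=> x; exact: lim_cst.
move=> e e0; exists 0%N => m n _ _.
suff -> : nrm (comb_sub v v) = 0 by [].
rewrite (@comb_norm_eval _ _ _ Kpsd _ [::]).
  by rewrite /comb_norm /comb_form big_nil sqrtC0.
by move=> x; rewrite eval_sub subrr /comb_eval big_nil.
Qed.

Lemma comb_lim_form_cvg u u' w f (l : C) : comb_lim u f -> comb_lim u' f ->
  comb_cauchy w ->
  (fun n => frm (u n) (w n)) @ \oo --> l -> (fun n => frm (u' n) (w n)) @ \oo --> l.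
Proof.
move=> uf uf' cw ul; have [cs s0] := comb_lim_scale_add (-1) uf uf'.
have z x : (fun n => ev (comb_scale (-1) (u n) ++ u' n) x) @ \oo --> (0 : C).
  by have := s0 x; rewrite mulN1r addNr.
pose proof (lim_add ul (comb_form_cvg0 cs cw z)) as h; move: h; rewrite addr0.
by apply: lim_ext => n; rewrite form_catl// form_scalel//; ring.
Qed.

Lemma comb_lim_form_unique u u' w w' f g (l l' : C) :
  comb_lim u f -> comb_lim u' f -> comb_lim w g -> comb_lim w' g ->
  (fun n => frm (u n) (w n)) @ \oo --> l ->
  (fun n => frm (u' n) (w' n)) @ \oo --> l' -> l = l'.
Proof.
move=> uf uf' wg wg' ul ul'.
have h := comb_lim_form_cvg uf uf' wg.1 ul.
have {}h : (fun n => frm (w n) (u' n)) @ \oo --> l^*.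
  by apply: lim_ext (lim_conj h) => n; rewrite form_conj.
have {}h : (fun n => frm (u' n) (w' n)) @ \oo --> l^*^*.
  apply: lim_ext (lim_conj (comb_lim_form_cvg wg wg' uf'.1 h)) => n.
  by rewrite form_conj.
by rewrite -[l]conjCK; exact: lim_unique h ul'.
Qed.

End CauchyCombinations.

Section KernelSpace.
Variables (R : realType) (X : Type).
Local Notation C := (Cplx R).

Record kernel := Kernel {
  kernel_fun :> X -> X -> C;
  kernel_psd : psd_kernel kernel_fun
}.

Variable K : kernel.
Let Kpsd := kernel_psd K.

(** The elements of the Hilbert space are genuine functions, namely the pointwise
    limits of Cauchy sequences of combinations, so that translations will act by
    translating the argument. *)
Definition kernel_limits : {pred (X -> C)} :=
  fun f => `[< exists u, comb_lim K u f >].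

Lemma kernel_limits_submod_closed : GRing.submod_closed kernel_limits.
Proof.
split.
  apply/asboolP; exists (fun=> [::]).
  have := comb_lim_cst Kpsd [::]; congr comb_lim.
  by apply/funext => x; rewrite /comb_eval big_nil.
move=> a f g /asboolP[u uf] /asboolP[w wg]; apply/asboolP.
by exists (fun n => comb_scale a (u n) ++ w n); exact: comb_lim_scale_add.
Qed.

HB.instance Definition _ :=
  GRing.isSubmodClosed.Build C (X -> C) kernel_limits kernel_limits_submod_closed.

Definition rkhs := {f : X -> C | f \in kernel_limits}.
HB.instance Definition _ := SubChoice.on rkhs.
HB.instance Definition _ := [SubChoice_isSubLmodule of rkhs by <:].

Definition rkhs_seq (f : rkhs) : nat -> seq (C * X) :=
  projT1 (cid (elimT (asboolP _) (valP f))).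

Lemma rkhs_seqP f : comb_lim K (rkhs_seq f) (val f).
Proof. exact: (projT2 (cid (elimT (asboolP _) (valP f)))). Qed.

Definition rkhs_dot (f g : rkhs) : C :=
  projT1 (cid (comb_form_cvg Kpsd (rkhs_seqP f).1 (rkhs_seqP g).1)).

Lemma rkhs_dotP f g u w : comb_lim K u (val f) -> comb_lim K w (val g) ->
  (fun n => comb_form K (u n) (w n)) @ \oo --> rkhs_dot f g.
Proof.
move=> uf wg; have [l ul] := comb_form_cvg Kpsd uf.1 wg.1.
suff <- : l = rkhs_dot f g by [].
apply: (comb_lim_form_unique Kpsd uf (rkhs_seqP f) wg (rkhs_seqP g) ul).
by rewrite /rkhs_dot; case: cid.
Qed.

Lemma rkhs_dot_conj f g : (rkhs_dot f g)^* = rkhs_dot g f.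
Proof.
pose proof (lim_conj (rkhs_dotP (rkhs_seqP f) (rkhs_seqP g))) as h.
apply: lim_unique h _.
apply: lim_ext (rkhs_dotP (rkhs_seqP g) (rkhs_seqP f)) => n.
by rewrite form_conj.
Qed.

Lemma rkhs_dot_linear (a : C) (f g h : rkhs) :
  rkhs_dot (a *: f + g) h = a * rkhs_dot f h + rkhs_dot g h.
Proof.
have fg := comb_lim_scale_add Kpsd a (rkhs_seqP f) (rkhs_seqP g).
apply: (lim_unique (rkhs_dotP (fg : comb_lim K _ (val (a *: f + g))) (rkhs_seqP h))).
apply: (lim_ext _ (lim_add (lim_mul (lim_cst a) (rkhs_dotP (rkhs_seqP f) (rkhs_seqP h)))
  (rkhs_dotP (rkhs_seqP g) (rkhs_seqP h)))) => n.
by rewrite form_catl// form_scalel.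
Qed.

Lemma rkhs_dot_bilinear :
  bilinear_for ( *%R : GRing.Scale.law C C) ((@Num.conj C) \; *%R : GRing.Scale.law C C)
    rkhs_dot.
Proof.
split=> [h a f g|h a f g]; first exact: rkhs_dot_linear.
by rewrite -!(rkhs_dot_conj _ h) rkhs_dot_linear rmorphD rmorphM.
Qed.

HB.instance Definition _ := bilinear_isBilinear.Build C rkhs rkhs C _ _
  rkhs_dot rkhs_dot_bilinear.

Lemma rkhs_dot_hermitian (f g : rkhs) :
  rkhs_dot f g = (-1) ^+ false * (rkhs_dot g f)^*.
Proof. by rewrite expr0 mul1r rkhs_dot_conj. Qed.

HB.instance Definition _ := isHermitianSesquilinear.Build C rkhs false
  (@Num.conj C) rkhs_dot rkhs_dot_hermitian.

Lemma comb_eval_limits v : comb_eval K v \in kernel_limits.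
Proof. by apply/asboolP; exists (fun=> v); exact: comb_lim_cst. Qed.

Definition rkhs_comb v : rkhs :=
  exist (fun f => is_true (f \in kernel_limits)) _ (comb_eval_limits v).

Lemma rkhs_comb_lim v : comb_lim K (fun=> v) (val (rkhs_comb v)).
Proof. exact: comb_lim_cst. Qed.

Definition kernel_vec x : rkhs := rkhs_comb [:: (1, x)].

Lemma rkhs_dot_kernel_vec f x : rkhs_dot f (kernel_vec x) = val f x.
Proof.
have [cu uf] := rkhs_seqP f.
apply: (lim_unique (rkhs_dotP (rkhs_seqP f) (rkhs_comb_lim [:: (1, x)]))).
by apply: lim_ext (uf x) => n; rewrite form_one.
Qed.

(** A vector of length zero is orthogonal to the generators by Cauchy-Schwarz, which
    is available for combinations and passes to the limit; so all its values
    vanish. *)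
Lemma rkhs_dot_gt0 (f : rkhs) : f != 0 -> 0 < rkhs_dot f f.
Proof.
move=> f0; have ff := rkhs_dotP (rkhs_seqP f) (rkhs_seqP f).
have dge0 : 0 <= rkhs_dot f f.
  by apply: lim_ge0 ff _; near=> n; exact: Kpsd.2.
rewrite lt_def dge0 andbT; apply: contra_neq f0 => d0.
apply/val_inj/funext => x /=; rewrite -rkhs_dot_kernel_vec.
have fx := rkhs_dotP (rkhs_seqP f) (rkhs_comb_lim [:: (1, x)]).
apply: norm_small_eq0 => e e0.
suff : 0 <= rkhs_dot f f * K x x - `|rkhs_dot f (kernel_vec x)| ^+ 2.
  rewrite d0 mul0r sub0r oppr_ge0 => h.
  have /eqP : `|rkhs_dot f (kernel_vec x)| ^+ 2 == 0 by rewrite eq_le h exprn_ge0.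
  by move/eqP; rewrite sqrf_eq0 => /eqP ->; exact: ltW.
rewrite normCK -mulNr -[- rkhs_dot _ _]mulN1r.
apply: (lim_ge0 (lim_add (lim_mul ff (lim_cst (K x x)))
   (lim_mul (lim_mul (lim_cst (-1)) fx) (lim_conj fx)))).
near=> n; rewrite mulN1r mulNr -normCK subr_ge0.
apply: le_trans (_ : (comb_norm K (rkhs_seq f n) * comb_norm K [:: (1, x)]) ^+ 2 <= _).
  by rewrite ler_pXn2r ?nnegrE ?mulr_ge0 ?comb_norm_ge0//; exact: comb_CauchySchwarz.
by rewrite exprMn !sqr_comb_norm form_one eval_one.
Unshelve. all: by end_near. Qed.

HB.instance Definition _ := isDotProduct.Build C rkhs rkhs_dot rkhs_dot_gt0.

End KernelSpace.

Section KernelHilbertSpace.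
Variables (R : realType) (X : Type) (K : kernel R X).
Local Notation C := (Cplx R).
Implicit Types (f g : rkhs K).

Definition rkhs_norm f : C := sqrtC (rkhs_dot f f).

Lemma rkhs_norm_triangle f g : rkhs_norm (f + g) <= rkhs_norm f + rkhs_norm g.
Proof. exact: dot_triangle. Qed.

Lemma rkhs_normZ (a : C) f : rkhs_norm (a *: f) = `|a| * rkhs_norm f.
Proof. exact: dot_sqrtZ. Qed.

Lemma rkhs_norm_eq0 f : rkhs_norm f = 0 -> f = 0.
Proof. by move=> /eqP; rewrite sqrtC_eq0 dnorm_eq0 => /eqP. Qed.

HB.instance Definition _ := Lmodule_isNormed.Build C (rkhs K)
  rkhs_norm_triangle rkhs_normZ rkhs_norm_eq0.

Lemma rkhs_dot_norm f : rkhs_dot f f = `|f| ^+ 2.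
Proof. by rewrite [RHS]sqrtCK. Qed.

End KernelHilbertSpace.

(** The centres of balls of radius [1 / (n + 1)] that belong to the filter form a
    Cauchy sequence, and the filter converges to its limit. *)
Lemma cauchy_seq_complete (R : realType) (V : normedModType (Cplx R)) :
  (forall u : nat -> V, (forall e : Cplx R, 0 < e -> exists N, forall m n,
     (N <= m)%N -> (N <= n)%N -> `|u m - u n| < e) ->
     exists l, forall e : Cplx R, 0 < e -> exists N, forall n,
       (N <= n)%N -> `|l - u n| < e) ->
  forall F : set_system V, ProperFilter F -> cauchy F -> cvg F.
Proof.
move=> complete F FF /cauchyP cF.
have en0 n : 0 < (n.+1%:R)^-1 :> Cplx R by rewrite invr_gt0.
have /choice[u uP] n := cF _ (en0 n).
have ucauchy m n : `|u m - u n| < m.+1%:R^-1 + n.+1%:R^-1.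
  have [z []] := filter_ex (@filterI _ F _ _ _ (uP m) (uP n)).
  rewrite -!ball_normE /= => zm zn; rewrite -(subrKA z).
  by apply: le_lt_trans (ler_normD _ _) _; rewrite ltrD// distrC.
have [e e0|l ul] := complete u.
  have e20 : 0 < e / 2 by rewrite divr_gt0.
  have [N HN] := exists_natSinv_lt e20; exists N => m n Nm Nn.
  by rewrite (lt_trans (ucauchy m n))// (splitr e) ltrD// HN.
apply/cvg_ex; exists l; apply/cvgrPdist_lt => e e0.
have e20 : 0 < e / 2 by rewrite divr_gt0.
have [N1 H1] := exists_natSinv_lt e20; have [N2 H2] := ul _ e20.
pose n := maxn N1 N2.
apply: filterS (uP n) => z; rewrite -ball_normE /= => uz.
rewrite -(subrKA (u n)) (splitr e).
apply: le_lt_trans (ler_normD _ _) _; rewrite ltrD//.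
  by apply: H2; exact: leq_maxr.
by apply: lt_trans uz _; apply: H1; exact: leq_maxl.
Qed.

Section KernelHilbertComplete.
Variables (R : realType) (X : Type) (K : kernel R X).
Local Notation C := (Cplx R).
Implicit Types (f g : rkhs K).
Let Kpsd := kernel_psd K.

Lemma rkhs_norm_comb v : `|rkhs_comb K v| = comb_norm K v.
Proof.
congr sqrtC; apply: (@lim_unique _ _ \oo _ (fun=> comb_form K v v)); last
   exact: lim_cst.
exact: rkhs_dotP (rkhs_comb_lim K v) (rkhs_comb_lim K v).
Qed.

Lemma rkhs_comb_sub v w : rkhs_comb K (comb_sub v w) = rkhs_comb K v - rkhs_comb K w.
Proof. by apply/val_inj/funext => x; rewrite /= eval_sub. Qed.

(** The combinations are dense: the squared distance from [f] to [u n] is the limit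
    over [m] of the squared distances from [u m] to [u n], which are small. *)
Lemma rkhs_comb_lim_norm f u : comb_lim K u (val f) ->
  forall e : C, 0 < e -> exists N, forall n, (N <= n)%N -> `|f - rkhs_comb K (u n)| < e.
Proof.
move=> [cu uf] e e0.
have e20 : 0 < e / 2 by rewrite divr_gt0.
have e2ge0 := ltW e20.
have [N HN] := cu _ e20; exists N => n Nn.
apply: (@le_lt_trans _ _ (e / 2)); last first.
  by rewrite ltr_pdivrMr// mulr_natr mulr2n ltrDl.
rewrite -(@ler_pXn2r _ 2)// ?nnegrE// -rkhs_dot_norm.
have l : comb_lim K (fun m => comb_sub (u m) (u n)) (val (f - rkhs_comb K (u n))).
  split; last first.
    move=> x.
    apply: (lim_ext _ (lim_add (uf x) (lim_cst (- comb_eval K (u n) x)))) => m.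
    by rewrite eval_sub.
  move=> d /cu[M HM]; exists M => m m' Mm Mm'; have := HM _ _ Mm Mm'.
  rewrite (@comb_norm_eval _ _ _ Kpsd _
    (comb_sub (comb_sub (u m) (u n)) (comb_sub (u m') (u n))))//.
  by move=> x; rewrite !eval_sub; ring.
rewrite -subr_ge0.
pose proof (lim_add (lim_cst ((e / 2) ^+ 2))
  (lim_mul (lim_cst (-1)) (rkhs_dotP l l))) as h.
rewrite -mulN1r; apply: (lim_ge0 h); exists N => // m Nm /=.
rewrite mulN1r subr_ge0 -sqr_comb_norm ler_pXn2r// ?nnegrE ?comb_norm_ge0//.
by apply: ltW; exact: HN.
Qed.

(** Approximating the terms of a Cauchy sequence by combinations gives a Cauchy
    sequence of combinations; its pointwise limit is an element of the space by
    definition. *)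
Lemma rkhs_complete (F : set_system (rkhs K)) : ProperFilter F -> cauchy F -> cvg F.
Proof.
apply: cauchy_seq_complete => f cf.
have en0 n : 0 < (n.+1%:R)^-1 :> C by rewrite invr_gt0.
have /choice[v vP] n : exists v, `|f n - rkhs_comb K v| < n.+1%:R^-1.
  have [N HN] := rkhs_comb_lim_norm (rkhs_seqP (f n)) (en0 n).
  by exists (rkhs_seq (f n) N); exact: HN.
have cv : comb_cauchy K v.
  move=> e e0; have e30 : 0 < e / 2 / 2 by rewrite !divr_gt0.
  have [N1 H1] := exists_natSinv_lt e30.
  have [N2 H2] := cf _ (divr_gt0 e0 (ltr0Sn _ 1)).
  exists (maxn N1 N2) => m n; rewrite !geq_max => /andP[m1 m2] /andP[n1 n2].
  rewrite -rkhs_norm_comb rkhs_comb_sub -(subrKA (f m)) (splitr e).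
  rewrite -[f m - _](subrKA (f n)) addrCA.
  apply: le_lt_trans (ler_normD _ _) _; rewrite ltrD//; first exact: H2.
  apply: le_lt_trans (ler_normD _ _) _; rewrite (splitr (e / 2)) ltrD//.
    by rewrite distrC (lt_trans (vP _))// H1.
  by rewrite (lt_trans (vP _))// H1.
have /choice[g gP] x : exists l : C, (fun n => comb_eval K (v n) x) @ \oo --> l.
  have [l hl] := comb_form_cvg Kpsd cv (comb_lim_cst Kpsd [:: (1, x)]).1.
  by exists l; apply: lim_ext hl => n; rewrite form_one.
have gl : g \in kernel_limits K by apply/asboolP; exists v.
pose g' : rkhs K := exist (fun h : X -> C => is_true (h \in kernel_limits K)) g gl.
exists g' => e e0; have e20 : 0 < e / 2 by rewrite divr_gt0.
have [N1 H1] := exists_natSinv_lt e20.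
have [N2 H2] := @rkhs_comb_lim_norm g' v (conj cv gP) _ e20.
exists (maxn N1 N2) => n; rewrite !geq_max => /andP[n1 n2].
rewrite -(subrKA (rkhs_comb K (v n))) (splitr e).
apply: le_lt_trans (ler_normD _ _) _; rewrite ltrD//; first exact: H2.
by rewrite distrC (lt_trans (vP _))// H1.
Qed.

HB.instance Definition _ := Uniform_isComplete.Build (rkhs K) rkhs_complete.

HB.instance Definition _ := hasInnerProduct.Build R (rkhs K) (@rkhs_dot_norm R X K).

Lemma ip_rkhs f x : ip f (kernel_vec K x) = val f x.
Proof. exact: rkhs_dot_kernel_vec. Qed.

Lemma ip_kernel_vec p q : ip (kernel_vec K p) (kernel_vec K q) = K p q.
Proof. by rewrite ip_rkhs /= eval_one. Qed.

(** This is the induction principle by which a property is extended from the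
    generators to all vectors. *)
Lemma kernel_vec_total (M : set (rkhs K)) : closed_subspace M ->
  (forall p, M (kernel_vec K p)) -> forall f, M f.
Proof.
move=> [M0 lM clM] Mk f; apply: clM => e e0.
have [N HN] := rkhs_comb_lim_norm (rkhs_seqP f) e0.
exists (rkhs_comb K (rkhs_seq f N)); last exact: HN.
elim: (rkhs_seq f N) => [|[c p] v IH].
  rewrite (_ : rkhs_comb K [::] = 0)//; apply/val_inj/funext => x.
  by rewrite /= /comb_eval big_nil.
rewrite (_ : rkhs_comb K _ = c *: kernel_vec K p + rkhs_comb K v); first exact: lM.
apply/val_inj/funext => x /=.
rewrite -[RHS]/(c * comb_eval K [:: (1, p)] x + comb_eval K v x).
by rewrite eval_one /comb_eval big_cons.
Qed.

End KernelHilbertComplete.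

(** * Operations on positive kernels *)

Section GramKernels.
Variables (R : realType).
Local Notation C := (Cplx R).

(** Schur's product theorem for Gram matrices: removing from all the first components
    their projection on one of them splits off a square. *)
Lemma gram_product_ge0 (H1 H2 : hilbertType R) (l : seq (H1 * H2)) :
  0 <= \sum_(p <- l) \sum_(q <- l) ip p.1 q.1 * ip p.2 q.2 :> C.
Proof.
have [n] := ubnP (size l); elim: n l => // n IH [|[z0 x0] l] /= szl.
  by rewrite big_nil.
pose a (z : H1) := ip z z0 / ip z0 z0.
have aP z : ip z z0 = a z * ip z0 z0.
  have [z00|z00] := eqVneq z0 0; first by rewrite z00 !ip0r mulr0.
  by rewrite /a divfK// dnorm_eq0.
have z00 : z0 - a z0 *: z0 = 0.
  rewrite /a; have [->|z00] := eqVneq z0 0; first by rewrite scaler0 subr0.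
  by rewrite divff ?dnorm_eq0// scale1r subrr.
clearbody a; pose z' (z : H1) := z - a z *: z0.
have aPr w : ip z0 w = (a w)^* * ip z0 z0.
  by rewrite -[LHS]ip_conj (aP w) rmorphM /= ip_conj.
have ipE z w : ip z w = ip (z' z) (z' w) + a z * (a w)^* * ip z0 z0.
  by rewrite /z' ipBl !ipBr !ipZl !ipZr (aP z) (aPr w); ring.
pose L := (z0, x0) :: l.
have -> : \sum_(p <- L) \sum_(q <- L) ip p.1 q.1 * ip p.2 q.2 =
    \sum_(p <- L) \sum_(q <- L) ip (z' p.1) (z' q.1) * ip p.2 q.2 +
    ip z0 z0 * ip (\sum_(p <- L) a p.1 *: p.2) (\sum_(p <- L) a p.1 *: p.2).
  rewrite ip_suml mulr_sumr -big_split /=; apply: eq_bigr => p _.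
  rewrite ip_sumr mulr_sumr -big_split /=; apply: eq_bigr => q _.
  by rewrite ipE ipZl ipZr; ring.
rewrite addr_ge0 ?mulr_ge0 ?dnorm_ge0// /L.
rewrite big_cons big_cons /= [z' z0]z00 ip0l mul0r add0r big1_seq ?add0r; last first.
  by move=> p _; rewrite ip0l mul0r.
under eq_bigr do rewrite big_cons /= [z' z0]z00 ip0r mul0r add0r.
have := IH [seq (z' p.1, p.2) | p <- l]; rewrite size_map => /(_ szl).
by rewrite big_map; under eq_bigr do rewrite big_map.
Qed.

Variable X : Type.
Implicit Types (K : X -> X -> C).

Lemma comb_formE K v w :
  comb_form K v w = \sum_(q <- w) \sum_(p <- v) q.1^* * (p.1 * K p.2 q.2).
Proof. by apply: eq_bigr => q _; rewrite mulr_sumr. Qed.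

Lemma psd_gram (H : hilbertType R) (k : X -> H) :
  psd_kernel (fun x y => ip (k x) (k y) : C).
Proof.
split=> [x y|v]; first by rewrite ip_conj.
suff -> : comb_form (fun x y => ip (k x) (k y) : C) v v =
  ip (\sum_(p <- v) p.1 *: k p.2) (\sum_(p <- v) p.1 *: k p.2) by exact: dnorm_ge0.
rewrite comb_formE ip_sumr; apply: eq_bigr => q _.
by rewrite ipZr ip_suml mulr_sumr; apply: eq_bigr => p _; rewrite ipZl.
Qed.

Lemma psd_mul K1 K2 : psd_kernel K1 -> psd_kernel K2 ->
  psd_kernel (fun x y => K1 x y * K2 x y).
Proof.
move=> K1p K2p; split=> [x y|v]; first by rewrite rmorphM K1p.1 K2p.1.
pose k1 := kernel_vec (Kernel K1p); pose k2 := kernel_vec (Kernel K2p).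
have := gram_product_ge0 [seq (p.1 *: k1 p.2, k2 p.2) | p <- v].
rewrite big_map exchange_big /= big_map; congr (0 <= _).
rewrite comb_formE; apply: eq_bigr => q _; apply: eq_bigr => p _.
by rewrite ipZl ipZr !ip_kernel_vec /=; ring.
Qed.

Lemma psd_add K1 K2 : psd_kernel K1 -> psd_kernel K2 ->
  psd_kernel (fun x y => K1 x y + K2 x y).
Proof.
move=> K1p K2p; split=> [x y|v]; first by rewrite rmorphD K1p.1 K2p.1.
have := addr_ge0 (K1p.2 v) (K2p.2 v); congr (0 <= _).
rewrite !comb_formE -big_split /=; apply: eq_bigr => q _.
by rewrite -big_split /=; apply: eq_bigr => p _; rewrite -mulrDr -mulrDr.
Qed.

Lemma psd_exp K n : psd_kernel K -> psd_kernel (fun x y => K x y ^+ n.+1).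
Proof.
move=> Kp; elim: n => [//|n IH].
exact: psd_mul Kp IH.
Qed.

Lemma psd_lim (K_ : nat -> X -> X -> C) K : (forall n, psd_kernel (K_ n)) ->
  (forall x y, (fun n => K_ n x y) @ \oo --> K x y) -> psd_kernel K.
Proof.
move=> Kp KK; split=> [x y|v].
  apply: lim_unique (KK y x) _; apply: lim_ext (lim_conj (KK x y)) => n.
  exact: esym ((Kp n).1 x y).
suff h : (fun n => comb_form (K_ n) v v) @ \oo --> comb_form K v v.
  by apply: lim_ge0 h _; near=> n; exact: (Kp n).2.
apply: (lim_ext (fun n => esym (comb_formE (K_ n) v v))); rewrite comb_formE.
apply: lim_sum => q; apply: lim_sum => p.
exact: lim_mul (lim_cst _) (lim_mul (lim_cst _) (KK _ _)).
Unshelve. all: by end_near. Qed.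

(** The kernel is the sum of the powers of [K] with exponents above [n], hence a limit
    of positive kernels. These are the tails of the geometric series of a
    coefficient. *)
Lemma psd_geometric K n : psd_kernel K -> (forall x y, `|K x y| < 1) ->
  psd_kernel (fun x y => K x y ^+ n.+1 / (1 - K x y)).
Proof.
move=> Kp K1; have N0 x y : 1 - K x y != 0.
  by rewrite subr_eq0; apply: contraTneq (K1 x y) => <-; rewrite normr1 ltxx.
apply: (@psd_lim (fun m x y => \sum_(i < m.+1) K x y ^+ (n + i).+1)) => [m|x y].
  elim: m => [|m IH].
    have := psd_exp n Kp; congr psd_kernel; apply/funext => x; apply/funext => y.
    by rewrite big_ord1 addn0.
  have := psd_add IH (psd_exp (n + m.+1) Kp); congr psd_kernel.
  by apply/funext => x; apply/funext => y; rewrite [RHS]big_ord_recr.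
pose proof (lim_add (lim_cst (K x y ^+ n.+1 / (1 - K x y)))
  (lim_mul (lim_cst (- (K x y ^+ n.+2 / (1 - K x y)))) (lim_expr (K1 x y)))) as h.
move: h; rewrite mulr0 addr0; apply: lim_ext => m.
transitivity (K x y ^+ n.+1 * (\sum_(i < m.+1) K x y ^+ i)).
  have h := subrX1 (K x y) m.+1; move: (\sum_(i < m.+1) _) h => S h.
  have {}h : 1 - K x y * K x y ^+ m = (1 - K x y) * S.
    by rewrite -exprS -[LHS]opprB h; ring.
  have -> : S = (1 - K x y * K x y ^+ m) / (1 - K x y).
    by apply/(mulIf (N0 x y)); rewrite divfK// h mulrC.
  by rewrite [K x y ^+ n.+2]exprS; field.
by rewrite mulr_sumr; apply: eq_bigr => i _; rewrite -exprD addSn.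
Qed.

End GramKernels.

Section BlockKernels.
Variables (R : realType).
Local Notation C := (Cplx R).

Lemma psd_comap (X Y : Type) (K : X -> X -> C) (h : Y -> X) :
  psd_kernel K -> psd_kernel (fun x y => K (h x) (h y)).
Proof.
move=> Kp; split=> [x y|v]; first exact: Kp.1.
have := Kp.2 [seq (p.1, h p.2) | p <- v]; congr (0 <= _).
by rewrite !comb_formE big_map; apply: eq_bigr => q _; rewrite big_map.
Qed.

(** The form is the sum over the blocks of the forms of the restrictions. In [cut],
    the terms outside a block get the coefficient 0 instead of being removed, which
    keeps all sums indexed by the same list. *)
Lemma psd_block (J X : eqType) (K : J -> X -> X -> C) :
  (forall a, psd_kernel (K a)) ->
  psd_kernel (fun p q : J * X => if p.1 == q.1 then K p.1 p.2 q.2 else 0).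
Proof.
move=> Kp; split=> [[a x] [b y]|v] /=.
  by rewrite eq_sym; case: eqP => [->|_]; rewrite ?rmorph0//; exact: (Kp b).1.
pose cut a := [seq ((if p.2.1 == a then p.1 else 0), p.2.2) | p <- v].
have : 0 <= \sum_(a <- undup [seq p.2.1 | p <- v]) comb_form (K a) (cut a) (cut a).
  by apply: sumr_ge0 => a _; exact: (Kp a).2.
congr (0 <= _).
under eq_bigr do rewrite comb_formE big_map.
rewrite comb_formE [LHS]exchange_big /=.
rewrite big_seq [RHS]big_seq; apply: eq_bigr => q qv.
under eq_bigr do rewrite big_map.
rewrite exchange_big /=; apply: eq_bigr => p _.
rewrite (bigD1_seq q.2.1) ?undup_uniq//=; last
  by rewrite mem_undup; apply/mapP; exists q.
rewrite eqxx big1 ?addr0; last first.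
  by move=> a aq; rewrite eq_sym (negPf aq) rmorph0 mul0r.
by case: eqP => [->|_]; rewrite ?mul0r ?mulr0.
Qed.

End BlockKernels.

(** * Representations defined by positive kernels *)

Section TranslationContinuity.
Variable G : topGroupType.

Lemma cvg_mulg (T : Type) (F : set_system T) (FF : Filter F) (f g : T -> G) (a b : G) :
  f @ F --> a -> g @ F --> b -> (fun x => f x * g x)%g @ F --> (a * b)%g.
Proof.
by move=> fa gb; apply: cvg_comp2 fa gb (mulg_continuous (a, b)).
Qed.

Lemma mulgr_continuous (a : G) : continuous (fun s : G => s * a)%g.
Proof. by move=> s; apply: cvg_mulg; [exact: cvg_id|exact: cvg_cst]. Qed.

End TranslationContinuity.

Section GelfandNaimarkSegal.
Variables (R : realType) (G : topGroupType) (I : Type).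
Local Notation C := (Cplx R).

(** The Gram kernel of the vectors [pi t (xi i)] when
    [phi i j = coef (xi i) (xi j)]. *)
Definition translation_kernel (phi : I -> I -> G -> C) : I * G -> I * G -> C :=
  fun p q => phi p.1 q.1 (q.2^-1 * p.2)%g.

Variable phi : I -> I -> G -> C.
Hypothesis phi_psd : psd_kernel (translation_kernel phi).
Hypothesis phi_cont : forall i, continuous (phi i i).

Let K := Kernel phi_psd.
Local Notation X := (I * G)%type.
Implicit Types (v w : seq (C * X)) (s t r : G) (i j : I) (f g : rkhs K).

Definition comb_shift s v : seq (C * X) := [seq (p.1, (p.2.1, s * p.2.2)%g) | p <- v].

Lemma eval_shift s v i t :
  comb_eval K (comb_shift s v) (i, t) = comb_eval K v (i, s^-1 * t)%g.
Proof.
rewrite /comb_eval big_map; apply: eq_bigr => p _; congr (_ * _).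
by rewrite /K /= /translation_kernel /= invgM invgK mulgA.
Qed.

Lemma form_shift s v w :
  comb_form K (comb_shift s v) (comb_shift s w) = comb_form K v w.
Proof.
rewrite /comb_form big_map; apply: eq_bigr => -[c [i t]] _; congr (_ * _).
by rewrite eval_shift mulKg.
Qed.

Lemma comb_shift_sub s v w :
  comb_shift s (comb_sub v w) = comb_sub (comb_shift s v) (comb_shift s w).
Proof. by rewrite /comb_sub /comb_shift map_cat /comb_scale -!map_comp. Qed.

Lemma comb_lim_shift s u (h : X -> C) : comb_lim K u h ->
  comb_lim K (fun n => comb_shift s (u n)) (fun p => h (p.1, s^-1 * p.2)%g).
Proof.
move=> [cu uh]; split; last first.
  by move=> [i t]; apply: lim_ext (uh _) => n; rewrite eval_shift.
move=> e /cu[N HN]; exists N => m n Nm Nn.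
by rewrite -comb_shift_sub /comb_norm form_shift; exact: HN.
Qed.

Lemma shift_limits s f : (fun p => val f (p.1, s^-1 * p.2)%g) \in kernel_limits K.
Proof.
by apply/asboolP; exists (fun n => comb_shift s (rkhs_seq f n));
  apply: comb_lim_shift; exact: rkhs_seqP.
Qed.

Definition rkhs_shift s f : rkhs K :=
  exist (fun h : X -> C => is_true (h \in kernel_limits K)) _ (shift_limits s f).

Lemma rkhs_shift_linear s : linear (rkhs_shift s).
Proof. by move=> a f g; apply/val_inj/funext => p. Qed.

HB.instance Definition _ s :=
  GRing.isLinear.Build C (rkhs K) (rkhs K) _ (rkhs_shift s) (rkhs_shift_linear s).

Lemma rkhs_shift_lim s f u : comb_lim K u (val f) ->
  comb_lim K (fun n => comb_shift s (u n)) (val (rkhs_shift s f)).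
Proof. exact: comb_lim_shift. Qed.

Lemma rkhs_shift_isometry s f g : ip (rkhs_shift s f) (rkhs_shift s g) = ip f g.
Proof.
have h := rkhs_dotP (rkhs_shift_lim s (rkhs_seqP f)) (rkhs_shift_lim s (rkhs_seqP g)).
apply: lim_unique h _.
apply: lim_ext (rkhs_dotP (rkhs_seqP f) (rkhs_seqP g)) => n.
by rewrite form_shift.
Qed.

Lemma rkhs_shift_norm s f : `|rkhs_shift s f| = `|f|.
Proof. by apply: ip_norm_eq; exact: rkhs_shift_isometry. Qed.

Lemma rkhs_shift1 f : rkhs_shift 1%g f = f.
Proof.
by apply/val_inj/funext => -[i t]; rewrite /= invg1 mul1g.
Qed.

Lemma rkhs_shiftM s t f : rkhs_shift (s * t)%g f = rkhs_shift s (rkhs_shift t f).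
Proof. by apply/val_inj/funext => -[i r]; rewrite /= invgM mulgA. Qed.

Lemma kernel_vec_shift s i t :
  rkhs_shift s (kernel_vec K (i, t)) = kernel_vec K (i, s * t)%g.
Proof.
by apply/val_inj/funext => -[j r] /=; rewrite -eval_shift.
Qed.

Lemma rkhs_shift_continuous f : continuous (fun s => rkhs_shift s f).
Proof.
suff h e : 0 < e -> forall s, \forall t \near s, `|rkhs_shift s f - rkhs_shift t f| < e.
  by move=> s; apply/cvgrPdist_lt => e e0; exact: h.
pose M : set (rkhs K) := [set f | forall e : C, 0 < e ->
  forall s, \forall t \near s, `|rkhs_shift s f - rkhs_shift t f| < e].
suff Mf : M f by exact: Mf.
apply: kernel_vec_total => [|[i r]]; last first.
  move=> {}e e0 s /=.
  pose g t := phi i i ((s * r)^-1 * (t * r))%g.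
  have gs : g t @[t --> s] --> (phi i i 1%g : C).
    have h : ((s * r)^-1 * (t * r))%g @[t --> s] --> ((s * r)^-1 * (s * r))%g.
      by apply: cvg_mulg; [exact: cvg_cst|exact: mulgr_continuous].
    by rewrite -(mulVg (s * r)%g); apply: (cvg_comp _ _ h); exact: phi_cont.
  (* The squared distance between two translates of a generator is twice the real
     part of phi i i 1 - g t. *)
  have e20 : 0 < e ^+ 2 / 2 by rewrite divr_gt0// exprn_gt0.
  have ege0 := ltW e0.
  move/cvgrPdist_lt : gs => /(_ _ e20); apply: filterS => t gt.
  rewrite -(@ltr_pXn2r _ 2)// ?nnegrE// -ip_norm !kernel_vec_shift.
  rewrite ipBl !ipBr !ip_kernel_vec /K /= /translation_kernel /= !mulVg.
  have -> : phi i i ((t * r)^-1 * (s * r))%g = (g t)^*.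
    by have := phi_psd.1 (i, t * r)%g (i, s * r)%g.
  have phi1 : (phi i i 1%g)^* = phi i i 1%g.
    by have := phi_psd.1 (i, 1%g) (i, 1%g); rewrite /translation_kernel /= mulVg.
  rewrite -/(g t).
  have -> : phi i i 1%g - (g t)^* - (g t - phi i i 1%g) =
      (phi i i 1%g - g t) + (phi i i 1%g - g t)^*.
    by rewrite rmorphB /= phi1; ring.
  apply: le_lt_trans (_ : `|phi i i 1%g - g t| + `|phi i i 1%g - g t| < _).
    rewrite -[X in _ <= _ + X]norm_conjC; apply: le_trans (ler_normD _ _).
    by apply: real_ler_norm; rewrite CrealE rmorphD /= conjCK addrC.
  by rewrite (splitr (e ^+ 2)) ltrD.
exact: strong_continuity_closed (rkhs_shift_linear) rkhs_shift_norm.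
Qed.

Definition rkhs_unirep : unirep R G :=
  UniRep rkhs_shift_isometry rkhs_shift1 rkhs_shiftM rkhs_shift_continuous.

End GelfandNaimarkSegal.

(** A matrix of functions whose kernel is positive is a matrix of coefficients of a
    single representation. Families indexed by [bool] give the two vectors of a
    coefficient; larger families play the part of direct sums. *)
Lemma GNS (R : realType) (G : topGroupType) (I : Type) (phi : I -> I -> G -> Cplx R) :
  psd_kernel (translation_kernel phi) -> (forall i, continuous (phi i i)) ->
  exists (pi : unirep R G) (xi : I -> rep_space pi),
    (forall i j, coef (xi i) (xi j) = phi i j) /\
    forall M, closed_subspace M -> (forall s i, M (pi s (xi i))) -> forall x, M x.
Proof.
move=> phi_psd phi_cont; pose pi := rkhs_unirep phi_psd phi_cont.
exists pi, (fun i => kernel_vec (Kernel phi_psd) (i, 1%g) : rep_space pi); split.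
  move=> i j; apply/funext => s.
  rewrite /coef [pi s _](kernel_vec_shift phi_psd s i 1%g) ip_kernel_vec mulg1.
  by rewrite /= /translation_kernel /= invg1 mul1g.
move=> M cM Mxi; apply: kernel_vec_total => // -[i s].
have := Mxi s i; rewrite [pi s _](kernel_vec_shift phi_psd s i 1%g).
by rewrite mulg1.
Qed.

(** * Matrix coefficients *)

Lemma continuous_geometric (K : numFieldType) (T : topologicalType) (f : T -> K) n :
  continuous f -> (forall s, `|f s| < 1) ->
  continuous (fun s => f s ^+ n.+1 / (1 - f s)).
Proof.
move=> cf f1 s.
have N0 : 1 - f s != 0.
  by rewrite subr_eq0; apply: contraTneq (f1 s) => <-; rewrite normr1 ltxx.
have fX k : f t ^+ k @[t --> s] --> f s ^+ k.
  elim: k => [|k IH]; first exact: cvg_cst.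
  rewrite exprS (_ : (fun t => f t ^+ k.+1) = fun t => f t * f t ^+ k).
    by apply: cvgM; [exact: cf|exact: IH].
  by apply/funext => t; rewrite exprS.
apply: cvgM; first exact: fX.
by apply: cvgV => //; apply: cvgB; [exact: cvg_cst|exact: cf].
Qed.

Section Coefficients.
Variables (R : realType) (G : topGroupType).
Local Notation C := (Cplx R).
Implicit Types (pi : unirep R G) (u v w : G -> C) (A : set (G -> C)) (s t : G).

Lemma rep_norm pi s (x : rep_space pi) : `|pi s x| = `|x|.
Proof. by apply: ip_norm_eq; exact: rep_isometry. Qed.

Lemma repVK pi s (x : rep_space pi) : pi s (pi s^-1%g x) = x.
Proof. by rewrite -repM mulgV rep1. Qed.

Lemma rep_adjoint pi s (x y : rep_space pi) : ip (pi s x) y = ip x (pi s^-1%g y).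
Proof. by rewrite -[y in LHS](repVK s) rep_isometry. Qed.

Lemma coef_translate pi s t (x y : rep_space pi) :
  coef (pi s x) (pi t y) = fun r => coef x y (t^-1 * r * s)%g.
Proof.
by apply/funext => r; rewrite /coef !repM [RHS]rep_adjoint invgK.
Qed.

Lemma coefBl pi (x x' y : rep_space pi) : coef (x - x') y = coef x y - coef x' y.
Proof. by apply/funext => s; rewrite /coef linearB ipBl. Qed.

Lemma coefBr pi (x y y' : rep_space pi) : coef x (y - y') = coef x y - coef x y'.
Proof. by apply/funext => s; rewrite /coef ipBr. Qed.

Lemma coef_linearl pi (a : C) (x x' y : rep_space pi) :
  coef (a *: x + x') y = a *: coef x y + coef x' y.
Proof. by apply/funext => s; rewrite /coef linearP ipDl ipZl. Qed.

Lemma coef_linearr pi (a : C) (x y y' : rep_space pi) :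
  coef x (a *: y + y') = a^* *: coef x y + coef x y'.
Proof. by apply/funext => s; rewrite /coef ipDr ipZr. Qed.

Lemma coef0l pi (y : rep_space pi) : coef 0 y = 0.
Proof. by apply/funext => s; rewrite /coef linear0 ip0l. Qed.

Lemma coef0r pi (x : rep_space pi) : coef x 0 = 0.
Proof. by apply/funext => s; rewrite /coef ip0r. Qed.

Lemma coefZl pi (a : C) (x y : rep_space pi) : coef (a *: x) y = a *: coef x y.
Proof. by rewrite -[_ *: x]addr0 coef_linearl coef0l addr0. Qed.

Lemma coefZr pi (a : C) (x y : rep_space pi) : coef x (a *: y) = a^* *: coef x y.
Proof. by rewrite -[_ *: y]addr0 coef_linearr coef0r addr0. Qed.

Lemma coef_norm pi (x y : rep_space pi) s : `|coef x y s| <= `|x| * `|y|.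
Proof. by rewrite -(rep_norm s x); exact: ip_CauchySchwarz. Qed.

Lemma coef_continuous pi (x y : rep_space pi) : continuous (coef x y).
Proof.
move=> s; apply/cvgrPdist_lt => e e0.
have y1 : 0 < `|y| + 1 by rewrite ltr_wpDl.
have /cvgrPdist_lt/(_ _ (divr_gt0 e0 y1)) := @rep_continuous _ _ pi x s.
apply: filterS => t; rewrite ltr_pdivlMr// => h.
rewrite /coef -ipBl; apply: le_lt_trans (ip_CauchySchwarz _ _) _.
by apply: le_lt_trans h; rewrite ler_wpM2l// lerDl.
Qed.

Lemma psd_coef (I : Type) pi (xi : I -> rep_space pi) :
  psd_kernel (translation_kernel (fun i j => coef (xi i) (xi j))).
Proof.
have := psd_gram (fun p : I * G => pi p.2 (xi p.1)); congr psd_kernel.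
apply/funext => -[i s]; apply/funext => -[j t] /=.
by rewrite /translation_kernel /coef /= repM [RHS]rep_adjoint invgK.
Qed.

Lemma FSnorm_le_coef pi (x y : rep_space pi) :
  FSnorm (coef x y) <= complex.Re (`|x| * `|y| : R[i]%C).
Proof.
apply: ge_inf; last by exists pi, x, y.
exists 0 => r [pi' [x' [y' [_ ->]]]].
by rewrite -(@ler0c R) -ge0_ReE mulr_ge0.
Qed.

Lemma FSnorm_lt_coef pi (x y : rep_space pi) (e : R) :
  `|x| * `|y| < e%:C%C -> FSnorm (coef x y) < e.
Proof.
move=> h; apply: le_lt_trans (FSnorm_le_coef x y) _.
by rewrite -real_ltC -ge0_ReE ?mulr_ge0.
Qed.

Lemma FSnorm_ltP u (e : R) : FS u -> FSnorm u < e ->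
  exists pi (x y : rep_space pi), u = coef x y /\ `|x| * `|y| < e%:C%C.
Proof.
move=> [pi0 [x0 [y0 u0]]] ue.
have [|r [pi [x [y [uE rE]]]] re] := inf_lt _ ue.
  by exists (complex.Re (`|x0| * `|y0| : R[i]%C)), pi0, x0, y0.
exists pi, x, y; split=> //; move: re.
by rewrite rE -real_ltC -ge0_ReE ?mulr_ge0.
Qed.

(** With equal norms of [x] and [y], all four coefficients among the two vectors are
    below 1 in modulus, so the geometric kernel exists, and both new vectors have the
    same norm, which is read off the diagonal coefficients at the identity. *)
Lemma FS_geometric pi (x y : rep_space pi) (a : C) n :
  `|x| = a -> `|y| = a -> a < 1 ->
  exists pi' (x' y' : rep_space pi'),
    (fun s => coef x y s ^+ n.+1 / (1 - coef x y s)) = coef x' y' /\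
    `|x'| * `|y'| = (a ^+ 2) ^+ n.+1 / (1 - a ^+ 2).
Proof.
move=> xa ya a1; pose xi (i : bool) := if i then x else y.
have xia i : `|xi i| = a by case: i.
have a0 : 0 <= a by rewrite -xa.
have coef1 i j s : `|coef (xi i) (xi j) s| < 1.
  apply: le_lt_trans (coef_norm _ _ _) _.
  by rewrite !xia -expr2 expr_lt1.
have [||pi' [xi' [xi'E _]]] := @GNS R G bool
    (fun i j s => coef (xi i) (xi j) s ^+ n.+1 / (1 - coef (xi i) (xi j) s)).
- have := psd_geometric n (psd_coef xi); apply => p q; exact: coef1.
- move=> i; apply: continuous_geometric; last exact: coef1.
  exact: coef_continuous.
exists pi', (xi' true), (xi' false); split; first by rewrite xi'E.
have norm' i : `|xi' i| ^+ 2 = (a ^+ 2) ^+ n.+1 / (1 - a ^+ 2).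
  have := congr1 (fun u => u 1%g) (xi'E i i); rewrite /coef !rep1 !ip_norm => ->.
  by rewrite xia.
have -> : `|xi' true| = `|xi' false|.
  by apply/eqP; rewrite -(@eqrXn2 _ 2)// !norm'.
by rewrite -expr2.
Qed.

End Coefficients.

(** * Boundedness of multiplicative functionals *)

Lemma geometric_tail (K : fieldType) (z : K) n : 1 - z != 0 ->
  z ^+ n.+1 / (1 - z) - z ^+ n.+1 = z ^+ n.+2 / (1 - z).
Proof. by move=> z1; rewrite [z ^+ n.+2]exprS; field. Qed.

Lemma geometric_quotient (K : fieldType) (z : K) : 1 - z != 0 ->
  z / (1 - z) = z + z * (z / (1 - z)).
Proof. by move=> z1; field. Qed.

Section MultiplicativeFunctionals.
Variables (R : realType) (G : topGroupType).
Local Notation C := (Cplx R).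
Implicit Types (pi : unirep R G) (u v w : G -> C) (s t : G).
Variable A : set (G -> C).

(** The same conditions as for the points of the spectrum, on a functional defined on
    all functions, whose values outside [A] are arbitrary. Sums, products and
    translates of elements of [A] can then be formed without proofs of membership in
    their types. *)
Definition multiplicative_functional (f : (G -> C) -> C) :=
  [/\ forall (c : C) u v, A u -> A v -> f (c *: u + v) = c * f u + f v,
      forall u v, A u -> A v -> f (u * v) = f u * f v
    & exists2 u, A u & f u != 0].

Hypothesis (algA : unital_subalgebra A) (clA : FSclosed A).

Let A1 : A 1. Proof. by case: algA. Qed.
Let AD u v : A u -> A v -> A (u + v). Proof. by case: algA => _ _ h _ _; exact: h. Qed.
Let AZ (c : C) u : A u -> A (c *: u). Proof. by case: algA => _ _ _ h _; exact: h. Qed.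
Let AM u v : A u -> A v -> A (u * v). Proof. by case: algA => _ _ _ _; exact. Qed.
Let A0 : A 0. Proof. by rewrite -(scale0r (1 : G -> C)); exact: AZ. Qed.

(** The partial sums lie in [A] and their distances to the series are at most the
    norms in [FS_geometric], which form a null sequence. *)
Lemma subalgebra_geometric pi (x y : rep_space pi) (a : C) :
  `|x| = a -> `|y| = a -> a < 1 -> A (coef x y) ->
  A (fun s => coef x y s / (1 - coef x y s)).
Proof.
move=> xa ya a1 Axy; have a0 : 0 <= a by rewrite -xa.
have geom := FS_geometric _ xa ya a1.
set w := coef x y in Axy geom *.
have w1 s : 1 - w s != 0.
  rewrite subr_eq0; apply: contraTneq a1 => w1.
  have := coef_norm x y s; rewrite -/w -w1 normr1 xa ya -expr2.
  by rewrite -[X in X <= _](expr1n _ 2) ler_pXn2r// ?nnegrE// => /le_gtF ->.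
pose S n : G -> C := \sum_(i < n) w ^+ i.+1.
have AS n : A (S n).
  rewrite /S; apply: (@big_ind _ A) => // i _.
  by elim: (i : nat) => [|k IH]; [rewrite expr1|rewrite exprS; exact: AM].
have tail n : (fun s => w s / (1 - w s)) - S n = (fun s => w s ^+ n.+1 / (1 - w s)).
  apply/funext => s; rewrite /S; elim: n => [|n IH].
    by rewrite big_ord0 subr0 expr1.
  rewrite big_ord_recr /= opprD addrA.
  rewrite -[LHS]/((((fun s => w s / (1 - w s)) -
    \sum_(i < n) w ^+ i.+1) s) - (w ^+ n.+1) s) IH.
  rewrite (_ : (w ^+ n.+1) s = w s ^+ n.+1); last first.
    by elim: n.+1 => [//|k {}IH]; rewrite !exprS -IH.
  exact: geometric_tail.
apply: clA; split.
  have [pi' [x' [y' [E _]]]] := geom 0; exists pi', x', y'; rewrite -E.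
  by apply/funext => s; rewrite expr1.
move=> e e0.
have b1 : a ^+ 2 < 1 by rewrite expr_lt1.
have nb1 : `|a ^+ 2| < 1 by rewrite ger0_norm// exprn_ge0.
have d0 : 0 < e%:C%C * (1 - a ^+ 2) by rewrite mulr_gt0 ?subr_gt0// real_ltC.
have /cvgrPdist_lt/(_ _ d0)[N _ HN] := lim_expr nb1.
exists (S N) => //; rewrite tail.
have [pi' [x' [y' [-> E]]]] := geom N; apply: FSnorm_lt_coef.
rewrite E ltr_pdivrMr ?subr_gt0//.
have := HN N.+1 (leqnSn N); rewrite sub0r normrN ger0_norm//.
by rewrite !exprn_ge0.
Qed.

Variable f : (G -> C) -> C.
Hypothesis fchar : multiplicative_functional f.

Let flin : forall (c : C) u v, A u -> A v -> f (c *: u + v) = c * f u + f v.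
Proof. by case: fchar. Qed.
Let fmul u v : A u -> A v -> f (u * v) = f u * f v.
Proof. by case: fchar => _ h _; exact: h. Qed.

Lemma functional0 : f 0 = 0.
Proof.
by have := flin (-1) A0 A0; rewrite scaler0 addr0 mulN1r addNr.
Qed.

Lemma functionalZ (c : C) u : A u -> f (c *: u) = c * f u.
Proof. by move=> Au; rewrite -[_ *: u]addr0 flin// functional0 addr0. Qed.

Lemma functionalB u v : A u -> A v -> f (u - v) = f u - f v.
Proof. by move=> Au Av; rewrite addrC -scaleN1r flin// mulN1r addrC. Qed.

Lemma functional1 : f 1 = 1.
Proof.
have [_ _ [u Au fu]] := fchar.
by apply/(mulIf fu); rewrite -fmul// !mul1r.
Qed.

(** If the bound failed, [w = coef x1 y] would have [f w = 1] and could be written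
    with two vectors of equal norm below 1. The sum [v] of its powers lies in [A] and
    satisfies [v = w + w * v], whence [f v = 1 + f v]. *)
Lemma functional_le pi (x y : rep_space pi) :
  A (coef x y) -> `|f (coef x y)| <= `|x| * `|y|.
Proof.
move=> Axy; rewrite real_leNgt ?realM ?normr_real//; apply/negP => fxy.
pose c := f (coef x y).
have c0 : c != 0 by rewrite -normr_gt0; apply: le_lt_trans fxy; rewrite mulr_ge0.
pose x1 := c^-1 *: x.
have E1 : coef x1 y = c^-1 *: coef x y.
  by rewrite coefZl.
have A1y : A (coef x1 y) by rewrite E1; exact: AZ.
have f1y : f (coef x1 y) = 1 by rewrite E1 functionalZ// mulVf.
have n1y : `|x1| * `|y| < 1.
  by rewrite normrZ normfV -mulrA mulrC ltr_pdivrMr ?mul1r// normr_gt0.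
(* Balancing the two norms requires both to be nonzero. *)
have [x10|x1N0] := eqVneq `|x1| 0.
  move/eqP: f1y; rewrite (_ : coef x1 y = 0) ?functional0 1?eq_sym ?oner_eq0//.
  apply/funext => s; apply/eqP; rewrite -normr_eq0 eq_le normr_ge0 andbT.
  by rewrite (le_trans (coef_norm _ _ _))// x10 mul0r.
have [y0|yN0] := eqVneq `|y| 0.
  move/eqP: f1y; rewrite (_ : coef x1 y = 0) ?functional0 1?eq_sym ?oner_eq0//.
  apply/funext => s; apply/eqP; rewrite -normr_eq0 eq_le normr_ge0 andbT.
  by rewrite (le_trans (coef_norm _ _ _))// y0 mulr0.
pose t := sqrtC (`|y| / `|x1|).
have t0 : 0 < t by rewrite sqrtC_gt0 divr_gt0// lt_def normr_ge0 andbT.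
have t2 : t ^+ 2 = `|y| / `|x1| by rewrite sqrtCK.
pose a := t * `|x1|.
have a0 : 0 <= a by rewrite mulr_ge0// ltW.
have a2 : a ^+ 2 = `|x1| * `|y| by rewrite exprMn t2 expr2 mulrA divfK// mulrC.
have xa : `|t *: x1| = a by rewrite normrZ gtr0_norm.
have ya : `|t^-1 *: y| = a.
  rewrite normrZ normfV gtr0_norm//; apply/(mulfI (lt0r_neq0 t0)).
  by rewrite mulVKf ?lt0r_neq0// mulrA -expr2 t2 divfK.
have a1 : a < 1 by rewrite -(@ltr_pXn2r _ 2)// ?nnegrE// a2 expr1n.
have Exy : coef (t *: x1) (t^-1 *: y) = coef x1 y.
  rewrite coefZl coefZr fmorphV /= (geC0_conj (ltW t0)) scalerA mulfV ?scale1r//.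
  exact: lt0r_neq0.
have Aw := A1y; rewrite -Exy in Aw.
have := subalgebra_geometric xa ya a1 Aw; rewrite Exy.
set w := coef x1 y in A1y f1y *; set v := fun s => _ => Av.
have w1 s : 1 - w s != 0.
  rewrite subr_eq0; apply: contraTneq n1y => w1.
  have := coef_norm x1 y s; rewrite -/w -w1 normr1.
  by move=> h; rewrite -real_leNgt ?normr_real ?realM ?real1.
have vE : v = w + w * v.
  apply/funext => s; rewrite -[RHS]/(w s + w s * v s) /v.
  exact: geometric_quotient.
have := congr1 f vE.
have -> : f (w + w * v) = f w + f (w * v).
  by have := flin 1 A1y (AM A1y Av); rewrite scale1r mul1r.
rewrite fmul// f1y mul1r => /eqP; rewrite -subr_eq subrr eq_sym.
by rewrite oner_eq0.
Qed.

End MultiplicativeFunctionals.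

(** * Closed translation-invariant spaces of coefficients *)

Section CyclicSubspaces.
Variables (R : realType) (G : topGroupType) (pi : unirep R G).
Local Notation C := (Cplx R).
Implicit Types (x y z : rep_space pi).

Definition invariant_subspace (M : set (rep_space pi)) :=
  closed_subspace M /\ forall s z, M z -> M (pi s z).

Definition cyclic x : set (rep_space pi) :=
  [set z | forall M, invariant_subspace M -> M x -> M z].

Lemma cyclic_self x : cyclic x x. Proof. by move=> M. Qed.

Lemma cyclic_invariant x : invariant_subspace (cyclic x).
Proof.
split; last by move=> s z xz M iM Mx; exact: iM.2 _ _ (xz M iM Mx).
split=> [M [[]]//|a y z xy xz M iM Mx|z hz M iM Mx].
  by have [[_ lM _] _] := iM; exact: lM (xy M iM Mx) (xz M iM Mx).
have [[_ _ clM] _] := iM; apply: clM => e /hz[y xy zy]; exists y => //.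
exact: xy M iM Mx.
Qed.

Lemma projection_rep (K : set (rep_space pi)) (P : rep_space pi -> rep_space pi) :
  invariant_subspace K -> (forall x, K (P x)) ->
  (forall x z, K z -> ip (x - P x) z = 0) ->
  forall s x, P (pi s x) = pi s (P x).
Proof.
move=> [cK iK] PK Porth s x; apply: (projection_unique cK PK Porth).
  exact: iK.
by move=> z Kz; rewrite -linearB rep_adjoint Porth//; exact: iK.
Qed.

(** Project [y] on the invariant subspace generated by [x], then project [x] on the
    invariant subspace generated by the new [y]. Neither step changes the coefficient,
    and the second one keeps the new [y] in the subspace generated by the new [x],
    since the projection commutes with the representation. *)
Lemma coef_cocyclic x y : exists x' y',
  [/\ coef x' y' = coef x y, cyclic y' x' & cyclic x' y'].
Proof.
have [P [PK Porth]] := projection_operator (cyclic_invariant x).1.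
pose y' := P y.
have [Q [QK Qorth]] := projection_operator (cyclic_invariant y').1.
exists (Q x), y'; split=> //.
  apply/funext => s; rewrite /coef.
  transitivity (ip (pi s x) y').
    rewrite !rep_adjoint; apply/eqP; rewrite eq_sym -subr_eq0 -ipBl Qorth//.
    exact: (cyclic_invariant y').2 _ _ (@cyclic_self y').
  apply/eqP; rewrite eq_sym -subr_eq0 -ipBr -ip_conj Porth ?rmorph0//.
  exact: (cyclic_invariant x).2 _ _ (@cyclic_self x).
have QE := projection_id (cyclic_invariant y').1 QK Qorth (@cyclic_self y').
pose N : set (rep_space pi) := [set z | cyclic (Q x) (Q z)].
suff : N y' by rewrite /N /= QE.
apply: PK; last exact: cyclic_self.
split.
  apply: (projection_preimage (cyclic_invariant y').1 QK Qorth).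
  exact: (cyclic_invariant (Q x)).1.
move=> s z; rewrite /N /= (projection_rep (cyclic_invariant y') QK Qorth).
exact: (cyclic_invariant (Q x)).2.
Qed.

End CyclicSubspaces.

Section CoefficientSpaces.
Variables (R : realType) (G : topGroupType).
Local Notation C := (Cplx R).
Implicit Types (pi : unirep R G) (u v w : G -> C) (s t : G).
Variable A : set (G -> C).
Hypotheses (A0 : A 0) (AD : forall u v, A u -> A v -> A (u + v))
  (AZ : forall (c : C) u, A u -> A (c *: u))
  (AFS : A `<=` @FS R G) (clA : FSclosed A).

(** A small change of [x] changes the coefficient by a coefficient of small norm. *)
Lemma coefl_closed pi (y : rep_space pi) : closed_subspace [set x | A (coef x y)].
Proof.
split=> [|a x x' Ax Ax'|x hx]; rewrite /=; first by rewrite coef0l.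
  by rewrite coef_linearl; apply: AD => //; exact: AZ.
apply: clA; split; first by exists pi, x, y.
move=> e e0; have y1 : 0 < `|y| + 1 by rewrite ltr_wpDl.
have eC : 0 < (e%:C%C : C) by rewrite real_ltC.
have [x' Ax' xx'] := hx _ (divr_gt0 eC y1); exists (coef x' y) => //.
rewrite -coefBl; apply: FSnorm_lt_coef.
move: xx'; rewrite ltr_pdivlMr//; apply: le_lt_trans.
by rewrite ler_wpM2l// lerDl.
Qed.

Lemma coefr_closed pi (x : rep_space pi) : closed_subspace [set y | A (coef x y)].
Proof.
split=> [|a y y' Ay Ay'|y hy]; rewrite /=; first by rewrite coef0r.
  by rewrite coef_linearr; apply: AD => //; exact: AZ.
apply: clA; split; first by exists pi, x, y.
move=> e e0; have x1 : 0 < `|x| + 1 by rewrite ltr_wpDl.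
have eC : 0 < (e%:C%C : C) by rewrite real_ltC.
have [y' Ay' yy'] := hy _ (divr_gt0 eC x1); exists (coef x y') => //.
rewrite -coefBr; apply: FSnorm_lt_coef.
move: yy'; rewrite ltr_pdivlMr//; apply: le_lt_trans.
by rewrite mulrC ler_wpM2l// lerDl.
Qed.

Lemma FSnorm0 : FSnorm (0 : G -> C) <= 0.
Proof.
have [pi [x [y _]]] := AFS A0.
by have := FSnorm_le_coef (0 : rep_space pi) y; rewrite coef0l normr0 mul0r.
Qed.

Lemma coef_spaceE pi : (forall x y : rep_space pi, A (coef x y)) ->
  (forall u, A u -> exists x y : rep_space pi, u = coef x y) -> A = coef_space pi.
Proof.
move=> Acoef Aex; apply/seteqP; split=> u.
  move=> Au; split; first exact: AFS.
  move=> e e0; exists u; last by rewrite subrr; exact: le_lt_trans FSnorm0 _.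
  have [x [y ->]] := Aex u Au.
  exists 1%N, (fun=> 1), (fun=> x), (fun=> y).
  by rewrite big_ord1 scale1r.
move=> [FSu happ]; apply: clA; split=> // e /happ[v [n [c [x [y vE]]]] uv].
exists v => //; rewrite vE; apply: (@big_ind _ A) => // i _; exact: AZ.
Qed.

Hypothesis trA : translation_invariant A.

Lemma coef_translate_in pi (x y : rep_space pi) s t :
  A (coef x y) -> A (coef (pi s x) (pi t y)).
Proof.
move=> Axy; rewrite coef_translate.
have := (trA s (trA t^-1%g Axy).1).2; congr A.
by apply/funext => r; rewrite mulgA.
Qed.

Lemma coefl_invariant pi (y : rep_space pi) :
  invariant_subspace [set x | A (coef x y)].
Proof.
split; first exact: coefl_closed.
by move=> s x /= /(coef_translate_in s 1%g); rewrite rep1.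
Qed.

Lemma coefr_invariant pi (x : rep_space pi) :
  invariant_subspace [set y | A (coef x y)].
Proof.
split; first exact: coefr_closed.
by move=> s y /= /(coef_translate_in 1%g s); rewrite rep1.
Qed.

(** For vectors generating the same subspace, one coefficient in [A] forces all four
    of them: the vectors with a coefficient in [A] against a fixed one form an
    invariant subspace. *)
Lemma translation_invariant_coef u : A u -> exists pi (xi : bool -> rep_space pi),
  u = coef (xi true) (xi false) /\ forall i j, A (coef (xi i) (xi j)).
Proof.
move=> Au; have [pi [x0 [y0 uE]]] := AFS Au.
have [x [y [E yx xy]]] := coef_cocyclic x0 y0.
exists pi, (fun i : bool => if i then x else y); split; first by rewrite E.
have Axy : A (coef x y) by rewrite E -uE.
have Axx : A (coef x x) by exact: yx (coefr_invariant x) Axy.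
have Ayy : A (coef y y) by exact: xy (coefl_invariant y) Axy.
have Ayx : A (coef y x) by exact: yx (coefr_invariant y) Ayy.
by case=> -[].
Qed.

(** The direct sum over all elements of [A] of the representations given by
    [translation_invariant_coef], each cut down to two generating vectors: the kernel
    has one block for every element of [A], and [bool] indexes the two vectors. *)
Lemma universal_representation : exists pi : unirep R G,
  (forall x y : rep_space pi, A (coef x y)) /\
  forall u, A u -> exists x y : rep_space pi, u = coef x y.
Proof.
have /choice[phi phiP] (a : A) : exists phi : bool -> bool -> G -> C,
    val a = phi true false /\ (forall i j, A (phi i j)) /\
    exists pi (xi : bool -> rep_space pi), phi = fun i j => coef (xi i) (xi j).
  have [pi [xi [uE Axi]]] := translation_invariant_coef (set_valP a).
  by exists (fun i j => coef (xi i) (xi j)); split=> //; split=> //; exists pi, xi.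
pose Phi (p q : A * bool) : G -> C := if p.1 == q.1 then phi p.1 p.2 q.2 else 0.
have [||pi [xi [xiE tot]]] := @GNS R G (A * bool)%type Phi.
- have block : psd_kernel (fun p q : A * (bool * G) =>
      if p.1 == q.1 then translation_kernel (phi p.1) p.2 q.2 else 0).
    apply: (@psd_block R A (bool * G)%type (fun a => translation_kernel (phi a))) => a.
    have [_ [_ [pi [xi ->]]]] := phiP a.
    exact: psd_coef.
  have := psd_comap (fun p : A * bool * G => (p.1.1, (p.1.2, p.2))) block.
  congr psd_kernel; apply/funext => -[[a i] s]; apply/funext => -[[b j] t] /=.
  by rewrite /translation_kernel /Phi /=; case: eqP.
- move=> [a i]; rewrite /Phi eqxx /=; have [_ [_ [pi [xi ->]]]] := phiP a.
  exact: coef_continuous.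
have APhi p q : A (Phi p q).
  by rewrite /Phi; case: eqP => // _; exact: (phiP p.1).2.1.
exists pi; split; last first.
  move=> u Au; pose a : A := exist _ u (mem_set Au).
  exists (xi (a, true)), (xi (a, false)).
  by rewrite xiE /Phi eqxx -(phiP a).1.
have Al p x : A (coef x (xi p)).
  apply: (tot _ (coefl_closed (xi p))) => s q.
  apply: (coefl_invariant (xi p)).2; rewrite /= xiE; exact: APhi.
move=> x y; apply: (tot _ (coefr_closed x)) => s p.
by apply: (coefr_invariant x).2; exact: Al.
Qed.

End CoefficientSpaces.

(** * Operators of multiplicative functionals *)

Section FunctionalOperators.
Variables (R : realType) (G : topGroupType).
Local Notation C := (Cplx R).
Implicit Types (u v w : G -> C) (s t : G).
Variable A : set (G -> C).
Hypotheses (algA : unital_subalgebra A) (clA : FSclosed A).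
Variable f : (G -> C) -> C.
Hypothesis fchar : multiplicative_functional A f.
Variable pi : unirep R G.
Implicit Types (x y : rep_space pi).
Hypothesis Acoef : forall x y, A (coef x y).

Lemma functional_operator : exists T : rep_space pi -> rep_space pi,
  [/\ linear T, forall x, `|T x| <= `|x| & forall x y, f (coef x y) = ip (T x) y].
Proof.
apply: Riesz_sesquilinear => [a x y z|a x y z|x y].
- by rewrite coef_linearl; have [-> //] := fchar.
- by rewrite coef_linearr; have [-> //] := fchar.
- exact: (functional_le algA clA fchar).
Qed.

Variable T : rep_space pi -> rep_space pi.
Hypotheses (linT : linear T) (leT : forall x, `|T x| <= `|x|)
  (fT : forall x y, f (coef x y) = ip (T x) y).

(** For a bounded [S] commuting with the representation, with adjoint [S'], the
    functions [coef (S x) y] and [coef x (S' y)] are equal; applying [f] shows that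
    [T] commutes with [S]. So [T] commutes with the commutant of every von Neumann
    algebra that contains the representation, hence lies in that algebra. *)
Lemma functional_operator_VN : VN pi T.
Proof.
move=> M [vnM piM]; have [Mb _ <-] := vnM.
split; first exact: contraction_bounded_ops.
move=> S [bS SM]; have [S' SS'] := adjoint_exists bS.
apply/funext => x; apply: ip_inj => y.
rewrite /= -fT SS' -fT; congr f; apply/funext => s; rewrite /coef -SS'.
have Ms : M (pi s) by apply: piM; exists s.
by rewrite -[S (pi s x)]/((S \o pi s) x) SM.
Qed.

End FunctionalOperators.

Section Introversion.
Variables (R : realType) (G : topGroupType).
Local Notation C := (Cplx R).
Implicit Types (u v w : G -> C) (s t : G) (f g h : (G -> C) -> C).

(** Applying a functional to the translates of a function. On coefficients this
    applies the operator of the functional to the first vector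
    ([left_introvert_coef]), or its adjoint to the second one
    ([right_introvert_coef]). *)
Definition left_introvert f u : G -> C := fun s => f (fun t => u (s * t)%g).
Definition right_introvert f u : G -> C := fun s => f (fun t => u (t * s)%g).
(** The involution which exchanges the two vectors of a coefficient ([tilde_coef]). *)
Definition tilde u : G -> C := fun s => (u s^-1%g)^*.
Definition functional_mul f g : (G -> C) -> C := fun u => f (left_introvert g u).
Definition functional_star f : (G -> C) -> C := fun u => (f (tilde u))^*.

Section CoefficientIntroversion.
Variables (f : (G -> C) -> C) (pi : unirep R G).
Implicit Types (x y : rep_space pi).
Variable T : rep_space pi -> rep_space pi.
Hypothesis fT : forall x y, f (coef x y) = ip (T x) y.

Lemma left_introvert_coef x y : left_introvert f (coef x y) = coef (T x) y.
Proof.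
apply/funext => s; rewrite /left_introvert /coef [RHS]rep_adjoint -fT.
by congr f; apply/funext => t; rewrite repM rep_adjoint.
Qed.

Lemma right_introvert_coef T' x y : adjoint T T' ->
  right_introvert f (coef x y) = coef x (T' y).
Proof.
move=> TT'; apply/funext => s; rewrite /right_introvert /coef -TT' -fT.
by congr f; apply/funext => t; rewrite repM.
Qed.

Lemma tilde_coef x y : tilde (coef x y) = coef y x.
Proof.
by apply/funext => s; rewrite /tilde /coef ip_conj [RHS]rep_adjoint.
Qed.

End CoefficientIntroversion.

Variable A : set (G -> C).
Hypotheses (algA : unital_subalgebra A) (clA : FSclosed A)
  (trA : translation_invariant A).
Local Notation character := (multiplicative_functional A).

Let AFS : A `<=` @FS R G. Proof. by case: algA. Qed.
Let A1 : A 1. Proof. by case: algA. Qed.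
Let AD u v : A u -> A v -> A (u + v). Proof. by case: algA => _ _ ? _ _; auto. Qed.
Let AZ (c : C) u : A u -> A (c *: u). Proof. by case: algA => _ _ _ ? _; auto. Qed.
Let AM u v : A u -> A v -> A (u * v). Proof. by case: algA => _ _ _ _; auto. Qed.
Let A0 : A 0. Proof. by rewrite -(scale0r (1 : G -> C)); exact: AZ. Qed.

(** For a given [u] there is a representation in which [u] is a single coefficient,
    while in a representation chosen beforehand it is only a limit of sums. *)
Lemma character_coef_operator f u : character f -> A u ->
  exists (pi : unirep R G) (x y : rep_space pi) (T T' : rep_space pi -> rep_space pi),
    [/\ u = coef x y, forall x y : rep_space pi, A (coef x y),
        forall x y, f (coef x y) = ip (T x) y & adjoint T T'].
Proof.
move=> fchar Au.
have [pi [Acoef /(_ u Au)[x [y uE]]]] := universal_representation A0 AD AZ AFS clA trA.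
have [T [linT leT fT]] := functional_operator algA clA fchar Acoef.
have [T' TT'] := adjoint_exists (contraction_bounded_ops linT leT).
by exists pi, x, y, T, T'.
Qed.

Lemma left_introvert_in f u : character f -> A u -> A (left_introvert f u).
Proof.
move=> fchar /(character_coef_operator fchar)[pi [x [y [T [T' [-> Acoef fT _]]]]]].
by rewrite (left_introvert_coef fT).
Qed.

Lemma right_introvert_in f u : character f -> A u -> A (right_introvert f u).
Proof.
move=> fchar /(character_coef_operator fchar)[pi [x [y [T [T' [-> Acoef fT TT']]]]]].
by rewrite (right_introvert_coef fT _ _ TT').
Qed.

Lemma tilde_in u : A u -> A (tilde u).
Proof.
move=> Au; have [pi [Acoef /(_ u Au)[x [y ->]]]] :=
  universal_representation A0 AD AZ AFS clA trA.
by rewrite tilde_coef.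
Qed.

(** Both sides are [ip (T (S x)) y], for [u = coef x y] and the operators [T] of [f]
    and [S] of [g]. *)
Lemma introvert_exchange f g u : character f -> character g -> A u ->
  f (left_introvert g u) = g (right_introvert f u).
Proof.
move=> fchar gchar Au.
have [pi [x [y [T [T' [-> Acoef fT TT']]]]]] := character_coef_operator fchar Au.
have [S [_ _ gS]] := functional_operator algA clA gchar Acoef.
by rewrite (left_introvert_coef gS) (right_introvert_coef fT _ _ TT') fT gS TT'.
Qed.

Let left_translate u s : A u -> A (fun t => u (s * t)%g).
Proof. by move=> /(trA s)[]. Qed.

Lemma functional_mul_char f g : character f -> character g ->
  character (functional_mul f g).
Proof.
move=> fchar gchar; have [flin fmul _] := fchar; have [glin gmul _] := gchar.
split=> [c u v Au Av|u v Au Av|]; rewrite /functional_mul.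
- rewrite -flin; [|exact: left_introvert_in|exact: left_introvert_in].
  congr f; apply/funext => s; rewrite /left_introvert.
  rewrite -[RHS]/(c * g (fun t => u (s * t)%g) + g (fun t => v (s * t)%g)).
  by rewrite -glin//; exact: left_translate.
- rewrite -fmul; [|exact: left_introvert_in|exact: left_introvert_in].
  congr f; apply/funext => s; rewrite /left_introvert.
  rewrite -[RHS]/(g (fun t => u (s * t)%g) * g (fun t => v (s * t)%g)).
  by rewrite -gmul//; exact: left_translate.
- exists 1 => //; have -> : left_introvert g 1 = 1.
    by apply/funext => s; exact: (functional1 algA gchar).
  by rewrite (functional1 algA fchar) oner_neq0.
Qed.

Lemma tilde_scale_add (c : C) u v : tilde (c *: u + v) = c^* *: tilde u + tilde v.
Proof. by apply/funext => s; rewrite /tilde [LHS]rmorphD [X in X + _]rmorphM. Qed.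

Lemma tildeM u v : tilde (u * v) = tilde u * tilde v.
Proof. by apply/funext => s; rewrite /tilde [LHS]rmorphM. Qed.

Lemma tildeK u : tilde (tilde u) = u.
Proof. by apply/funext => s; rewrite /tilde invgK conjCK. Qed.

Lemma functional_star_char f : character f -> character (functional_star f).
Proof.
move=> fchar; have [flin fmul _] := fchar.
split=> [c u v Au Av|u v Au Av|]; rewrite /functional_star.
- rewrite tilde_scale_add flin; [|exact: tilde_in|exact: tilde_in].
  by rewrite rmorphD rmorphM /= conjCK.
- by rewrite tildeM fmul; [rewrite rmorphM|exact: tilde_in|exact: tilde_in].
- exists 1 => //; rewrite (_ : tilde 1 = 1); last first.
    by apply/funext => s; rewrite /tilde [LHS]rmorph1.
  by rewrite (functional1 algA fchar) rmorph1 oner_neq0.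
Qed.

Lemma functional_mulA f g h u :
  functional_mul f (functional_mul g h) u = functional_mul (functional_mul f g) h u.
Proof.
rewrite /functional_mul; congr f; apply/funext => s.
rewrite /left_introvert; congr g; apply/funext => t; congr h.
by apply/funext => r; rewrite mulgA.
Qed.

Lemma functional_starM f g u : character f -> character g -> A u ->
  functional_star (functional_mul f g) u =
  functional_mul (functional_star g) (functional_star f) u.
Proof.
move=> fchar gchar Au; rewrite /functional_star /functional_mul; congr (_^*).
(* The inversion in tilde exchanges left and right translations. *)
rewrite introvert_exchange//; last exact: tilde_in.
congr g; apply/funext => s; rewrite /tilde /left_introvert /right_introvert conjCK.
by congr f; apply/funext => t; rewrite invgM.
Qed.

End Introversion.

(** * The spectrum *)

Section SpectrumTopology.
Variables (R : realType) (G : topGroupType).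
Local Notation C := (Cplx R).
Implicit Types (u v w : G -> C) (s t : G).
Variable A : set (G -> C).
Hypotheses (algA : unital_subalgebra A) (clA : FSclosed A).

Definition functional_of (chi : {ptws A -> C}) : (G -> C) -> C :=
  fun u => if pselect (A u) is left Au then chi (exist _ u (mem_set Au)) else 0.

Lemma functional_ofE (chi : {ptws A -> C}) (a : A) : functional_of chi (val a) = chi a.
Proof.
rewrite /functional_of; case: pselect => [Aa|]; last by case; exact: set_valP.
by congr chi; exact/val_inj.
Qed.

Lemma functional_of_char (chi : {ptws A -> C}) :
  spectrum A chi -> multiplicative_functional A (functional_of chi).
Proof.
case: algA => _ _ AD AZ AM [clin cmul [a chia]].
have toA u : A u -> exists a : A, u = val a.
  by move=> Au; exists (exist _ u (mem_set Au)).
split.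
- move=> c u v Au Av; have [b E] := toA _ (AD _ _ (AZ c _ Au) Av); rewrite E.
  move: E; have [a1 ->] := toA _ Au; have [a2 ->] := toA _ Av => E.
  by rewrite !functional_ofE; exact: clin.
- move=> u v Au Av; have [b E] := toA _ (AM _ _ Au Av); rewrite E.
  move: E; have [a1 ->] := toA _ Au; have [a2 ->] := toA _ Av => E.
  by rewrite !functional_ofE; exact: cmul.
- by exists (val a); [exact: set_valP|rewrite functional_ofE].
Qed.

Definition restrict_functional (f : (G -> C) -> C) : {ptws A -> C} :=
  fun a => f (val a).

Lemma restrict_spectrum f :
  multiplicative_functional A f -> spectrum A (restrict_functional f).
Proof.
case=> flin fmul [u Au fu]; split.
- by move=> c a b d; rewrite /restrict_functional => ->; apply: flin; exact: set_valP.
- by move=> a b d; rewrite /restrict_functional => ->; apply: fmul; exact: set_valP.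
- by exists (exist _ u (mem_set Au)).
Qed.

Lemma eval_ptws_continuous (a : A) : continuous (fun chi : {ptws A -> C} => chi a).
Proof. exact: (@proj_continuous A (fun=> C) a). Qed.

(** Linearity and multiplicativity are equations between evaluations. Being nonzero is
    not an equation, but for multiplicative functionals it is equivalent to taking the
    value 1 at the unit. *)
Lemma spectrum_closed : closed (spectrum A : set {ptws A -> C}).
Proof.
move=> chi clchi.
pose F := within (spectrum A : set {ptws A -> C}) (nbhs chi).
have FF : ProperFilter F by exact: within_nbhs_proper.
have ev (a : A) : (fun psi : {ptws A -> C} => psi a) @ F --> chi a.
  by apply: cvg_trans (@eval_ptws_continuous a chi); apply: cvg_app; exact: cvg_within.
have inF (P : {ptws A -> C} -> Prop) : (forall psi, spectrum A psi -> P psi) -> F P.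
  by move=> h; exact/nearW.
have F_eq (c d : {ptws A -> C} -> C) (l m : C) :
    (forall psi, spectrum A psi -> c psi = d psi) ->
    c @ F --> l -> d @ F --> m -> l = m.
  move=> cd cl dm; apply: (lim_unique cl); apply: cvg_trans dm.
  by apply: near_eq_cvg; apply: inF => psi /cd.
split.
- move=> c a b d E.
  apply: (F_eq _ _ _ _ _ (ev d) (lim_add (lim_mul (lim_cst c) (ev a)) (ev b))).
  by move=> psi [h _ _]; exact: h.
- move=> a b d E; apply: (F_eq _ _ _ _ _ (ev d) (lim_mul (ev a) (ev b))).
  by move=> psi [_ h _]; exact: h.
- have A1 : A 1 by case: algA.
  exists (exist _ 1 (mem_set A1)).
  rewrite (F_eq _ (fun=> 1) _ 1 _ (ev _)) ?oner_neq0//; last exact: cvg_cst.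
  by move=> psi /functional_of_char/functional1 <- //; rewrite -functional_ofE.
Qed.

Lemma spectrum_compact_set : compact (spectrum A : set {ptws A -> C}).
Proof.
have /choice[r rP] (a : A) :
    exists r : R, forall chi, spectrum A chi -> `|chi a| <= r%:C%C.
  have [AFS _ _ _ _] := algA; have [pi [x [y E]]] := AFS _ (set_valP a).
  exists (complex.Re (`|x| * `|y| : R[i]%C)) => chi /functional_of_char chichar.
  rewrite -functional_ofE E -ge0_ReE ?mulr_ge0//.
  by apply: (functional_le algA clA chichar); rewrite -E; exact: set_valP.
have cP := @tychonoff A (fun=> C) (fun a => complex_square (r a))
  (fun a => @complex_square_compact R (r a)).
apply: (@subclosed_compact {ptws A -> C} _ _ spectrum_closed cP).
by move=> chi Schi a; exact/norm_complex_square/rP.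
Qed.

Lemma compact_set_type (T : topologicalType) (B : set T) :
  compact B -> compact [set: B].
Proof.
move=> cB F FF _.
have FB : (set_val @ F) B.
  by apply: (@filterE _ F) => b; rewrite set_valE; exact: set_valP.
have [x [Bx xF]] := cB (set_val @ F) _ FB.
exists (exist _ x (mem_set Bx)); split=> // P Q FP [_ [[V oV <-] Vx VQ]].
have FP' : (set_val @ F) (set_val @` P).
  by apply: (@filterS _ F _ P) => // b Pb; exists b.
have [y [[b Pb <-] Vb]] := xF _ V FP' (open_nbhs_nbhs (conj oV Vx)).
by exists b; split=> //; exact: VQ.
Qed.

Lemma spectrum_compact : compact [set: spectrum A].
Proof. exact/compact_set_type/spectrum_compact_set. Qed.

Lemma eval_spectrum_continuous (a : A) :
  continuous (fun chi : spectrum A => \val chi a).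
Proof.
move=> chi; apply: (@continuous_comp _ _ _ (set_val : spectrum A -> {ptws A -> C})
  (fun psi => psi a)); last exact: eval_ptws_continuous.
exact: initial_continuous.
Qed.

(** The topology of the spectrum is induced from a product, so it is generated by the
    evaluations. *)
Lemma continuous_spectrum (T : topologicalType) (g : T -> spectrum A) :
  (forall a, continuous (fun z : T => \val (g z) a)) -> continuous g.
Proof.
move=> cg z P [_ [[V oV <-] Vz VP]].
have h : (fun z => \val (g z) : {ptws A -> C}) @ z --> (\val (g z) : {ptws A -> C}).
  apply/cvg_sup => a U [_ [[W oW <-] Wz WU]].
  have gW : \forall z' \near z, W (\val (g z') a).
    by exact: cg a z W (open_nbhs_nbhs (conj oW Wz)).
  by apply: (@filterS _ (nbhs z) _ _ _ _ gW) => z' Wz'; exact: WU.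
have gV : \forall z' \near z, V (\val (g z')).
  by exact: h V (open_nbhs_nbhs (conj oV Vz)).
by apply: (@filterS _ (nbhs z) _ _ _ _ gV) => z' Vz'; exact: VP.
Qed.

End SpectrumTopology.

Section SpectrumSemigroup.
Variables (R : realType) (G : topGroupType).
Local Notation C := (Cplx R).
Implicit Types (u v w : G -> C).
Variable A : set (G -> C).
Hypotheses (algA : unital_subalgebra A) (clA : FSclosed A)
  (trA : translation_invariant A).
Implicit Types (chi psi : spectrum A).

Local Notation fn chi := (functional_of (\val chi)).

Lemma spectrum_char chi : multiplicative_functional A (fn chi).
Proof. by apply: functional_of_char => //; exact: set_valP. Qed.

Lemma functional_of_restrict f u : A u ->
  functional_of (restrict_functional f : {ptws A -> C}) u = f u.
Proof.
move=> Au; exact: (functional_ofE (restrict_functional f : {ptws A -> C})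
  (exist _ u (mem_set Au))).
Qed.

Definition spectrum_of f (fchar : multiplicative_functional A f) : spectrum A :=
  exist (fun chi : {ptws A -> C} =>
      is_true (chi \in (spectrum A : set {ptws A -> C}))) _
    (mem_set (restrict_spectrum fchar)).

Lemma spectrum_ext chi psi : (forall u, A u -> fn chi u = fn psi u) -> chi = psi.
Proof.
move=> h; apply/val_inj/funext => a.
by rewrite -!functional_ofE; apply: h; exact: set_valP.
Qed.

Definition spectrum_mul chi psi : spectrum A :=
  spectrum_of (functional_mul_char algA clA trA
    (spectrum_char chi) (spectrum_char psi)).

Definition spectrum_star chi : spectrum A :=
  spectrum_of (functional_star_char algA clA trA (spectrum_char chi)).

Lemma spectrum_mulE chi psi u : A u ->
  fn (spectrum_mul chi psi) u = functional_mul (fn chi) (fn psi) u.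
Proof. exact: functional_of_restrict. Qed.

Lemma spectrum_starE chi u : A u ->
  fn (spectrum_star chi) u = functional_star (fn chi) u.
Proof. exact: functional_of_restrict. Qed.

Lemma eval_fn_continuous u : A u -> continuous (fun chi : spectrum A => fn chi u).
Proof.
move=> Au; have h := @eval_spectrum_continuous R G A (exist _ u (mem_set Au)).
by apply: (continuous_eq _ h) => chi; rewrite -functional_ofE.
Qed.

Lemma continuous_to_spectrum (g : spectrum A -> spectrum A) :
  (forall u, A u -> continuous (fun chi => fn (g chi) u)) -> continuous g.
Proof.
move=> cg; apply: continuous_spectrum => a.
have h := cg _ (set_valP a); apply: (continuous_eq _ h) => chi.
by rewrite functional_ofE.
Qed.

Lemma left_introvert_translate f g u s :
  (forall v, A v -> f v = g v) -> A u ->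
  left_introvert f u s = left_introvert g u s.
Proof. by move=> fg Au; apply: fg; have [] := trA s Au. Qed.

Lemma spectrum_semigroup :
  semitopological_star_semigroup spectrum_mul spectrum_star.
Proof.
have inA chi u := left_introvert_in algA clA trA (spectrum_char chi) (u := u).
have tA u := tilde_in algA clA trA (u := u).
split.
- move=> chi psi phi; apply: spectrum_ext => u Au.
  rewrite !spectrum_mulE// [RHS]/functional_mul spectrum_mulE; last exact: inA.
  transitivity (functional_mul (fn chi) (functional_mul (fn psi) (fn phi)) u);
    last exact: functional_mulA.
  congr (fn chi _); apply/funext => s.
  by apply: left_introvert_translate => // v Av; rewrite spectrum_mulE.
- move=> chi; split; apply: continuous_to_spectrum => u Au.
    (* By exchange, the product is the value of psi at a fixed element of A. *)
    have cR := eval_fn_continuous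
      (right_introvert_in algA clA trA (spectrum_char chi) Au).
    apply: (continuous_eq _ cR) => psi; rewrite spectrum_mulE//.
    by rewrite /functional_mul (introvert_exchange algA clA trA (spectrum_char chi)
      (spectrum_char psi)).
  have cL := eval_fn_continuous (inA chi _ Au).
  by apply: (continuous_eq _ cL) => psi; rewrite spectrum_mulE.
- move=> chi; apply: spectrum_ext => u Au.
  rewrite spectrum_starE// /functional_star spectrum_starE; last exact: tA.
  by rewrite /functional_star tildeK conjCK.
- move=> chi psi; apply: spectrum_ext => u Au.
  rewrite spectrum_starE// /functional_star spectrum_mulE; last exact: tA.
  rewrite -/(functional_star _ u).
  rewrite (functional_starM algA clA trA (spectrum_char chi) (spectrum_char psi))//.
  rewrite spectrum_mulE// /functional_mul spectrum_starE; last exact: inA.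
  congr functional_star; apply/funext => s.
  by apply: left_introvert_translate => // v Av; rewrite spectrum_starE.
- apply: continuous_to_spectrum => u Au.
  have cT := continuous_conj (eval_fn_continuous (tA u Au)).
  by apply: (continuous_eq _ cT) => psi; rewrite spectrum_starE.
Qed.

Section Representation.
Variable pi : unirep R G.
Hypothesis Api : A = coef_space pi.
Implicit Types x y : rep_space pi.

Lemma coef_in_coef_space x y : A (coef x y).
Proof.
rewrite Api; split; first by exists pi, x, y.
move=> e e0; exists (coef x y); last first.
  by rewrite -coefBl subrr; apply: FSnorm_lt_coef; rewrite normr0 mul0r real_ltC.
exists 1%N, (fun=> 1), (fun=> x), (fun=> y).
by rewrite big_ord1 scale1r.
Qed.

Lemma spectrum_operator chi : exists T : rep_space pi -> rep_space pi,
  VN pi T /\ forall x y, fn chi (coef x y) = ip (T x) y.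
Proof.
have [T [linT leT fT]] :=
  functional_operator algA clA (spectrum_char chi) coef_in_coef_space.
exists T; split=> //.
exact: (functional_operator_VN linT leT fT).
Qed.

(** Sums of coefficients of [pi] are dense in [A], and the difference of the two
    functionals at [u - v] is at most twice the norm of [u - v] by [functional_le]. *)
Lemma spectrum_eq_coef chi psi :
  (forall x y, fn chi (coef x y) = fn psi (coef x y)) -> chi = psi.
Proof.
move=> h; apply: spectrum_ext => u Au.
have [AFS A1 AD AZ AM] := algA.
have A0 : A 0 by rewrite -(scale0r (1 : G -> C)); exact: AZ.
have span v : coef_span pi v -> A v /\ fn chi v = fn psi v.
  move=> [n [c [x [y ->]]]].
  apply: (@big_ind _ (fun v => A v /\ fn chi v = fn psi v)).
  - by rewrite !(functional0 algA (spectrum_char _)).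
  - move=> v1 v2 [Av1 E1] [Av2 E2]; split; first exact: AD.
    have fnD (phi : spectrum A) : fn phi (v1 + v2) = fn phi v1 + fn phi v2.
      by have [/(_ 1 v1 v2 Av1 Av2)] := spectrum_char phi; rewrite scale1r mul1r.
    by rewrite !fnD E1 E2.
  - move=> i _; split; first by apply: AZ; exact: coef_in_coef_space.
    have Ai := coef_in_coef_space (x i) (y i).
    by rewrite !(functionalZ algA (spectrum_char _))// h.
apply/eqP; rewrite -subr_eq0; apply/eqP; apply: norm_small_eq0 => e e0.
have e20 : 0 < e / 2 by rewrite divr_gt0.
have : coef_space pi u by rewrite -Api.
move=> [_ /(_ _ (Re_gt0 e20))[v /span[Av E] uv]].
have Auv : A (u - v) by rewrite -scaleN1r; apply: AD => //; exact: AZ.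
have small (phi : spectrum A) : `|fn phi (u - v)| <= e / 2.
  have [pi' [x [y [uvE xy]]]] := FSnorm_ltP (AFS _ Auv) uv.
  apply: ltW; rewrite [e / 2](gt0_ReE e20); apply: le_lt_trans xy.
  rewrite uvE; apply: (functional_le algA clA (spectrum_char phi)).
  by rewrite -uvE.
have -> : fn chi u - fn psi u = fn chi (u - v) - fn psi (u - v).
  rewrite (functionalB (spectrum_char chi) Au Av).
  by rewrite (functionalB (spectrum_char psi) Au Av) E; ring.
apply: le_trans (ler_normB _ _) _; rewrite (splitr e).
by rewrite lerD.
Qed.

End Representation.

End SpectrumSemigroup.

Theorem corollary1p6 (R : realType) (G : topGroupType)
    (hausG : hausdorff_space G) (lcG : locally_compact [set: G])
    (A : set (G -> Cplx R))
    (algA : unital_subalgebra A) (clA : FSclosed A)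
    (trA : translation_invariant A) :
  exists (mul : spectrum A -> spectrum A -> spectrum A)
         (star : spectrum A -> spectrum A),
    [/\ compact [set: spectrum A],
        semitopological_star_semigroup mul star,
        exists pi : unirep R G, A = coef_space pi
      & forall pi : unirep R G, A = coef_space pi ->
          exists iota : spectrum A -> (rep_space pi -> rep_space pi),
            [/\ injective iota /\ (forall chi, VN pi (iota chi)),
                forall chi x y (u : A), \val u = coef x y ->
                  \val chi u = ip (iota chi x) y,
                forall chi psi, iota (mul chi psi) = iota chi \o iota psi
              & forall chi, adjoint (iota chi) (iota (star chi))]].
Proof.
exists (spectrum_mul algA clA trA), (spectrum_star algA clA trA); split.
- exact: spectrum_compact.
- exact: spectrum_semigroup.
- have [AFS A1 AD AZ AM] := algA.
  have A0 : A 0 by rewrite -(scale0r (1 : G -> Cplx R)); exact: AZ.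
  have [pi [Acoef Aex]] := universal_representation A0 AD AZ AFS clA trA.
  exists pi; exact: coef_spaceE.
move=> pi Api; have /choice[iota iotaP] := spectrum_operator algA clA Api.
have coefA := coef_in_coef_space Api.
exists iota; split.
- split; last by move=> chi; case: (iotaP chi).
  move=> chi psi E; apply: (spectrum_eq_coef algA clA Api) => x y.
  by rewrite (iotaP chi).2 (iotaP psi).2 E.
- by move=> chi x y u E; rewrite -(iotaP chi).2 -E functional_ofE.
- move=> chi psi; apply/funext => x; apply: ip_inj => y.
  rewrite -(iotaP _).2 spectrum_mulE// /functional_mul.
  by rewrite (left_introvert_coef (iotaP psi).2) (iotaP chi).2.
move=> chi x y; rewrite -[RHS]ip_conj -(iotaP (spectrum_star _ _ _ chi)).2.
by rewrite spectrum_starE// /functional_star tilde_coef conjCK (iotaP chi).2.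
Qed.
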